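(* Let $\overline{\mathbf{CSTS}_\bullet}$ be the full subcategory of $\mathbf{CSTS}_\bullet$ of reduced star-shaped transition systems, and let $R_\bullet^\perp:\mathbf{CSTS}_\bullet\to\overline{\mathbf{CSTS}_\bullet}$ be the left adjoint of the inclusion functor. Then $R_\bullet^\perp$ induces a Quillen equivalence between the left determined Olschok model category $\mathbf{CSTS}_\bullet$ and the category $\overline{\mathbf{CSTS}_\bullet}$ equipped with the discrete model structure. In particular, a map $f$ of star-shaped Cattani-Sassone transition systems is a weak equivalence of $\mathbf{CSTS}_\bullet$ if and only if it becomes an isomorphism after the identification of all past-similar states, i.e. if and only if $R_\bullet^\perp(f)$ is an isomorphism.
   Context: Fix an infinite set $\Sigma$ of labels. A transition presystem $X$ consists of a set $S(X)$ of states, a set $L(X)$ of actions with a labelling map $\mu:L(X)\to\Sigma$, and for each $n\geq 1$ a set $T_n(X)\subset S(X)\times L(X)^n\times S(X)$ of $n$-transitions; $T(X)=\bigcup_{n\geq 1}T_n(X)$. A map $f:X\to Y$ consists of a map $S(X)\to S(Y)$ and a label-preserving map $L(X)\to L(Y)$ such that the image $(f(\alpha),f(u_1),\dots,f(u_n),f(\beta))$ of every transition $(\alpha,u_1,\dots,u_n,\beta)$ of $X$ is a transition of $Y$. A Cattani-Sassone transition system is a transition presystem satisfying: (Multiset) if $(\alpha,u_1,\dots,u_n,\beta)$ is a transition with $n\geq2$, so is $(\alpha,u_{\sigma(1)},\dots,u_{\sigma(n)},\beta)$ for every permutation $\sigma$; (Patching) for $n\geq 3$, $p,q\geq 1$,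 $p+q<n$, if $(\alpha,u_1,\dots,u_n,\beta)$, $(\alpha,u_1,\dots,u_p,\nu_1)$, $(\nu_1,u_{p+1},\dots,u_n,\beta)$, $(\alpha,u_1,\dots,u_{p+q},\nu_2)$, $(\nu_2,u_{p+q+1},\dots,u_n,\beta)$ are transitions, so is $(\nu_1,u_{p+1},\dots,u_{p+q},\nu_2)$; (All actions used) every action $u$ occurs in some $1$-transition $(\alpha,u,\beta)$; (CSA2) for every transition $(\alpha,u_1,\dots,u_n,\beta)$ with $n\geq 2$ and every $1\leq p<n$ there is a unique state $\nu$ such that $(\alpha,u_1,\dots,u_p,\nu)$ and $(\nu,u_{p+1},\dots,u_n,\beta)$ are transitions; (CSA1) if $(\alpha,u,\beta)$ and $(\alpha,v,\beta)$ are transitions with $\mu(u)=\mu(v)$, then $u=v$. Their category is $\mathbf{CSTS}$. A set is identified with the object having it as set of states and no actions. Cofibrations of $\mathbf{CSTS}$. $C_n[x_1,\dots,x_n]$ ($n\geq 0$, $x_i\in\Sigma$) has states $\{0,1\}^n$, actions $(x_1,1),\dots,(x_n,n)$ with $\mu(x_i,i)=x_i$, and transitions all tuples $((\epsilon_1,\dots,\epsilon_n),(x_{i_1},i_1),\dots,(x_{i_d},i_d),(\epsilon'_1,\dots,\epsilon'_n))$, $d\geq1$, with $i_1,\dots,i_d$ distinct, $\epsilon_i\leq\epsilon'_i$ for all $i$, and $\epsilon_i\neq\epsilon'_i$ iff $i\in\{i_1,\dots,i_d\}$. For $n\geq1$, $\partial C_n[x_1,\dots,x_n]$ is obtained by removing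 all $n$-transitions (for $n=1$ it is the set $\{0,1\}$, without action). $C_0$ is the one-state set. $\uparrow\! x\!\uparrow$ has states $1,2,3,4$, one action $x$ and the transitions $(1,x,2)$, $(3,x,4)$. Let $\mathcal I=\{\varnothing\to\{0\}\}\cup\{\partial C_n[x_1,\dots,x_n]\subset C_n[x_1,\dots,x_n]\mid n\geq1, x_i\in\Sigma\}\cup\{C_0\sqcup C_0\sqcup C_1[x]\to\,\uparrow\! x\!\uparrow\;\mid x\in\Sigma\}$, the last maps being bijective on states. The cofibrations of $\mathbf{CSTS}$ are the maps having the left lifting property with respect to all maps having the right lifting property with respect to $\mathcal I$. Star-shaped objects. A pointed transition system $(X,* )$ is an object $X$ of $\mathbf{CSTS}$ with a distinguished state $*$ (base state); maps preserve base states. For $w=x_1\dots x_n\in\Sigma^n$, $n\geq0$, the path $(P(w),0)$ has states $0,\dots,n$, base state $0$, actions $(x_i,i)$ with label $x_i$, and transitions $(i-1,(x_i,i),i)$, $1\leq i\leq n$. $(X,* )$ is star-shaped if every state is the image of $n$ under some map $(P(w),0)\to(X,* )$ with $w\in\Sigma^n$, $n\geq0$. $\mathbf{CSTS}_\bullet$ is the category of star-shaped (Cattani-Sassone) transition systems. Cylinder. A state $\alpha$ of $(X,* )$ is internal if $\alpha=*$ or there are transitions $(\gamma,u_1,\dots,u_n,\delta)$, $(\gamma,u_1,\dots,u_p,\alpha)$, $(\alpha,u_{p+1},\dots,u_n,\delta)$ with $n\geq2$, $1\leq p<n$; otherwise external. $\mathrm{Cyl}_\bullet(X,* )$ has states $\mathrm{Int}(X,*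 )\times\{0\}\sqcup\mathrm{Ext}(X,* )\times\{0,1\}$ (internal and external states), base state $( *,0)$, actions $L(X)$, and transitions the tuples $((\alpha,\epsilon_0),u_1,\dots,u_n,(\beta,\epsilon_{n+1}))$ with $(\alpha,u_1,\dots,u_n,\beta)\in T(X)$; $\gamma^\epsilon:(X,* )\to\mathrm{Cyl}_\bullet(X,* )$ ($\epsilon=0,1$) is the identity on actions and sends a state $\alpha$ to $(\alpha,\epsilon)$ if external, to $(\alpha,0)$ if internal. Two maps $f,g:(X,* )\to(Y,* )$ are homotopic (equivalently, left homotopic for $\mathrm{Cyl}_\bullet$, or right homotopic for its right adjoint $\mathrm{Path}_\bullet$) if there is $H:\mathrm{Cyl}_\bullet(X,* )\to(Y,* )$ with $H\gamma^0=f$, $H\gamma^1=g$. Model structure. $\mathbf{CSTS}_\bullet$ is equipped with the unique model structure whose cofibrations are the maps with underlying map a cofibration of $\mathbf{CSTS}$ and whose class of weak equivalences is the smallest class $\mathcal W$ containing all maps with the right lifting property with respect to cofibrations, closed under retracts and two-out-of-three, and such that the class of cofibrations in $\mathcal W$ is closed under pushouts and transfinite compositions (left determined). All objects are cofibrant. Equivalently (Olschok construction): for a set $\mathcal I_\bullet$ of generating cofibrations, put $\Lambda_0=(\mathcal I_\bullet\star\gamma^0)\cup(\mathcal I_\bullet\star\gamma^1)$, $\Lambda_{n+1}=\Lambda_n\star\gamma$, where $\gamma=\gamma^0\sqcup\gamma^1$ and, for $f:A\to B$ and $\alpha:F\Rightarrow F'$, $f\star\alpha:F'A\sqcup_{FA}FB\to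 F'B$; an object is fibrant iff it is injective with respect to $\bigcup_n\Lambda_n$, and $f:A\to B$ is a weak equivalence iff for every fibrant $Z$ precomposition with $f$ is a bijection between the sets of maps into $Z$ modulo homotopy. Past-similarity. States $\alpha,\beta$ of a star-shaped $(X,* )$ are past-similar if there are $n\geq0$, $w\in\Sigma^n$ and two homotopic maps $(P(w),0)\rightrightarrows(X,* )$ sending $n$ to $\alpha$ and to $\beta$ respectively. $(X,* )$ is reduced if two states are past-similar if and only if they are equal. The discrete model structure on a category: all maps are cofibrations and fibrations, the weak equivalences are the isomorphisms. ''$R_\bullet^\perp$ induces a Quillen equivalence'' means that the adjunction between $R_\bullet^\perp$ and the inclusion is a Quillen equivalence with left adjoint $R_\bullet^\perp$. *)

(* Defs.v *)
From mathcomp Require Import all_boot.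
From mathcomp Require Import boolp classical_sets functions cardinality.
From Stdlib Require Import Permutation.

Set Implicit Arguments.
Unset Strict Implicit.
Unset Printing Implicit Defensive.

(** * Categories *)

Declare Scope cat_scope.
Delimit Scope cat_scope with cat.

Record category := Category {
  ob :> Type;
  hom : ob -> ob -> Type;
  idm : forall X, hom X X;
  comp : forall X Y Z, hom Y Z -> hom X Y -> hom X Z;
  comp1m : forall X Y (f : hom X Y), comp (idm Y) f = f;
  compm1 : forall X Y (f : hom X Y), comp f (idm X) = f;
  compA : forall X Y Z T (h : hom Z T) (g : hom Y Z) (f : hom X Y),
    comp h (comp g f) = comp (comp h g) f }.

Arguments hom {c} X Y.
Arguments idm {c} X.
Arguments comp {c X Y Z} g f.
Notation "g ∘ f" := (comp g f) (at level 40, left associativity) : cat_scope.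
Local Open Scope cat_scope.

Definition morph_class (C : category) := forall X Y : C, hom X Y -> Prop.

Definition is_iso (C : category) : morph_class C := fun X Y f =>
  exists g : hom Y X, g ∘ f = idm X /\ f ∘ g = idm Y.

Definition capm (C : category) (K L : morph_class C) : morph_class C :=
  fun X Y f => K X Y f /\ L X Y f.

Definition is_initial (C : category) (I : C) :=
  forall X : C, exists! f : hom I X, True.

Definition is_terminal (C : category) (T : C) :=
  forall X : C, exists! f : hom X T, True.

Definition lifts (C : category) (A B X Y : C) (i : hom A B) (p : hom X Y) :=
  forall (a : hom A X) (b : hom B Y), p ∘ a = b ∘ i ->
  exists h : hom B X, h ∘ i = a /\ p ∘ h = b.

Definition llp (C : category) (K : morph_class C) : morph_class C :=
  fun A B i => forall (X Y : C) (p : hom X Y), K X Y p -> lifts i p.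

Definition rlp (C : category) (K : morph_class C) : morph_class C :=
  fun X Y p => forall (A B : C) (i : hom A B), K A B i -> lifts i p.

Definition is_retract (C : category) (X Y X' Y' : C)
    (f : hom X Y) (g : hom X' Y') :=
  exists (i : hom X X') (r : hom X' X) (j : hom Y Y') (s : hom Y' Y),
    [/\ r ∘ i = idm X, s ∘ j = idm Y, g ∘ i = j ∘ f & f ∘ r = s ∘ g].

Definition is_pushout (C : category) (A B X Y : C)
    (f : hom A B) (g : hom A X) (f' : hom X Y) (g' : hom B Y) :=
  f' ∘ g = g' ∘ f /\
  forall (Z : C) (x : hom X Z) (b : hom B Z), x ∘ g = b ∘ f ->
  exists! h : hom Y Z, h ∘ f' = x /\ h ∘ g' = b.

Definition retract_closed (C : category) (K : morph_class C) :=
  forall (X Y X' Y' : C) (f : hom X Y) (g : hom X' Y'),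
  is_retract f g -> K X' Y' g -> K X Y f.

Definition two_of_three (C : category) (K : morph_class C) :=
  forall (X Y Z : C) (f : hom X Y) (g : hom Y Z),
  [/\ K X Y f -> K Y Z g -> K X Z (g ∘ f),
      K X Y f -> K X Z (g ∘ f) -> K Y Z g
    & K Y Z g -> K X Z (g ∘ f) -> K X Y f].

Definition pushout_closed (C : category) (K : morph_class C) :=
  forall (A B X Y : C) (f : hom A B) (g : hom A X) (f' : hom X Y) (g' : hom B Y),
  is_pushout f g f' g' -> K A B f -> K X Y f'.

(** ** Transfinite compositions *)

(* The nonzero ordinals indexing transfinite compositions are represented by
   types with a strict well-order and a least element. *)
Record well_order := WellOrder {
  wo_sort :> Type;
  wlt : wo_sort -> wo_sort -> Prop;
  wlt_trans : forall i j k, wlt i j -> wlt j k -> wlt i k;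
  wlt_total : forall i j, wlt i j \/ i = j \/ wlt j i;
  wlt_wf : well_founded wlt;
  wbot : wo_sort;
  wbot_least : forall i, wbot = i \/ wlt wbot i }.

Definition wle (I : well_order) (i j : I) := i = j \/ wlt i j.

Definition wsucc (I : well_order) (i j : I) :=
  wlt i j /\ forall k : I, wlt i k -> wle j k.

Definition wlimit (I : well_order) (j : I) :=
  wlt (wbot I) j /\ forall i : I, wlt i j -> exists k : I, wlt i k /\ wlt k j.

Record chain (C : category) (I : well_order) := Chain {
  chain_ob :> I -> C;
  chain_map : forall i j : I, wle i j -> hom (chain_ob i) (chain_ob j);
  chain_id : forall (i : I) (l : wle i i), chain_map l = idm (chain_ob i);
  chain_comp : forall (i j k : I) (l : wle i j) (m : wle j k) (n : wle i k),
    chain_map m ∘ chain_map l = chain_map n }.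

(* [c] is a colimit cocone of the restriction of [F] to the indices in [P]. *)
Definition is_chain_colimit (C : category) (I : well_order) (F : chain C I)
    (P : I -> Prop) (Z : C) (c : forall i : I, P i -> hom (F i) Z) :=
  (forall (i j : I) (l : wle i j) (pi : P i) (pj : P j),
     c j pj ∘ chain_map F l = c i pi) /\
  forall (Y : C) (d : forall i : I, P i -> hom (F i) Y),
    (forall (i j : I) (l : wle i j) (pi : P i) (pj : P j),
       d j pj ∘ chain_map F l = d i pi) ->
  exists! h : hom Z Y, forall (i : I) (pi : P i), h ∘ c i pi = d i pi.

Definition smooth_chain (C : category) (I : well_order) (F : chain C I) :=
  forall j : I, wlimit j ->
  is_chain_colimit (F := F) (P := fun i => wlt i j)
    (fun i (l : wlt i j) => chain_map F (or_intror l)).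

Definition transfinite_closed (C : category) (K : morph_class C) :=
  forall (I : well_order) (F : chain C I), smooth_chain F ->
  (forall (i j : I) (l : wle i j), wsucc i j -> K (F i) (F j) (chain_map F l)) ->
  forall (Z : C) (c : forall i : I, True -> hom (F i) Z),
  is_chain_colimit (F := F) (P := fun=> True) c ->
  K (F (wbot I)) Z (c (wbot I) Logic.I).

(** ** Functors and adjunctions *)

Record functor (C D : category) := Functor {
  fobj :> C -> D;
  fmap : forall X Y : C, hom X Y -> hom (fobj X) (fobj Y);
  fmap_id : forall X : C, fmap (idm X) = idm (fobj X);
  fmap_comp : forall (X Y Z : C) (g : hom Y Z) (f : hom X Y),
    fmap (g ∘ f) = fmap g ∘ fmap f }.

Arguments fmap {C D} _ {X Y} _.

(* [F] is left adjoint to [G]. *)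
Record adjunction (C D : category) (F : functor C D) (G : functor D C) :=
  Adjunction {
  adj_unit : forall X : C, hom X (G (F X));
  adj_counit : forall Y : D, hom (F (G Y)) Y;
  adj_unit_nat : forall (X X' : C) (f : hom X X'),
    adj_unit X' ∘ f = fmap G (fmap F f) ∘ adj_unit X;
  adj_counit_nat : forall (Y Y' : D) (g : hom Y Y'),
    adj_counit Y' ∘ fmap F (fmap G g) = g ∘ adj_counit Y;
  adj_triangleL : forall X : C,
    adj_counit (F X) ∘ fmap F (adj_unit X) = idm (F X);
  adj_triangleR : forall Y : D,
    fmap G (adj_counit Y) ∘ adj_unit (G Y) = idm (G Y) }.

Definition full_sub (C : category) (P : C -> Prop) : category :=
  @Category {X : C | P X} (fun X Y => hom (sval X) (sval Y))
    (fun X => idm (sval X)) (fun X Y Z g f => g ∘ f)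
    (fun X Y f => comp1m f) (fun X Y f => compm1 f)
    (fun X Y Z T h g f => compA h g f).

Definition inclusion (C : category) (P : C -> Prop) : functor (full_sub P) C :=
  @Functor (full_sub P) C (fun X => sval X) (fun X Y f => f)
    (fun X => erefl) (fun X Y Z g f => erefl).

(** ** Model structures *)

Definition is_wfs (C : category) (L R : morph_class C) :=
  [/\ forall (X Y : C) (f : hom X Y), L X Y f <-> llp R f,
      forall (X Y : C) (f : hom X Y), R X Y f <-> rlp L f
    & forall (X Y : C) (f : hom X Y), exists (Z : C) (i : hom X Z) (p : hom Z Y),
        [/\ L X Z i, R Z Y p & p ∘ i = f]].

Record model_structure (C : category) := ModelStructure {
  cof : morph_class C;
  fib : morph_class C;
  weq : morph_class C;
  weq_two_of_three : two_of_three weq;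
  cof_trivfib_wfs : is_wfs cof (capm fib weq);
  trivcof_fib_wfs : is_wfs (capm cof weq) fib }.

Definition cofibrant (C : category) (M : model_structure C) (X : C) :=
  exists (I : C) (i : hom I X), is_initial I /\ cof M i.

Definition fibrant (C : category) (M : model_structure C) (X : C) :=
  exists (T : C) (t : hom X T), is_terminal T /\ fib M t.

(* The closure conditions on the weak equivalences, relative to a fixed class
   [K] of cofibrations. *)
Definition is_localizer (C : category) (K W : morph_class C) :=
  [/\ forall (X Y : C) (p : hom X Y), rlp K p -> W X Y p,
      two_of_three W,
      retract_closed W,
      pushout_closed (capm K W)
    & transfinite_closed (capm K W)].

Definition left_determined (C : category) (M : model_structure C) :=
  is_localizer (cof M) (weq M) /\
  forall W : morph_class C, is_localizer (cof M) W ->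
  forall (X Y : C) (f : hom X Y), weq M f -> W X Y f.

Definition quillen_adjunction (C D : category) (M : model_structure C)
    (N : model_structure D) (F : functor C D) (G : functor D C)
    (adj : adjunction F G) :=
  (forall (X Y : C) (f : hom X Y), cof M f -> cof N (fmap F f)) /\
  (forall (X Y : C) (f : hom X Y), cof M f -> weq M f ->
     cof N (fmap F f) /\ weq N (fmap F f)).

Definition quillen_equivalence (C D : category) (M : model_structure C)
    (N : model_structure D) (F : functor C D) (G : functor D C)
    (adj : adjunction F G) :=
  quillen_adjunction M N adj /\
  forall (X : C) (Y : D), cofibrant M X -> fibrant N Y ->
  forall f : hom (F X) Y, weq N f <-> weq M (fmap G f ∘ adj_unit adj X).

Definition all_maps (C : category) : morph_class C := fun X Y f => True.

Lemma iso_two_of_three (C : category) : two_of_three (@is_iso C).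
Proof.
move=> X Y Z f g; split.
- move=> [f' [f'f ff']] [g' [g'g gg']]; exists (f' ∘ g'); split.
    by rewrite -compA (compA g') g'g comp1m.
  by rewrite -compA (compA f) ff' comp1m.
- move=> [f' [f'f ff']] [h [hgf gfh]]; exists (f ∘ h); split; last by rewrite compA.
  by rewrite -[LHS]compm1 -ff' !compA -(compA _ g f) -(compA f) hgf compm1.
- move=> [g' [g'g gg']] [h [hgf gfh]]; exists (h ∘ g); split; first by rewrite -compA.
  by rewrite -[LHS]comp1m -g'g -!compA (compA f) (compA g) (compA g f h) gfh comp1m.
Qed.

Lemma iso_lifts (C : category) (A B X Y : C) (i : hom A B) (p : hom X Y) :
  is_iso i \/ is_iso p -> lifts i p.
Proof.
move=> ip a b pabi; case: ip => -[j [ji ij]].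
  by exists (a ∘ j); rewrite -compA ji compm1 compA pabi -compA ij compm1.
by exists (j ∘ b); rewrite -compA -pabi !compA ji ij !comp1m.
Qed.

Lemma self_lifts_iso (C : category) (X Y : C) (f : hom X Y) :
  lifts f f -> is_iso f.
Proof. by move=> /(_ (idm X) (idm Y)); rewrite compm1 comp1m; apply. Qed.

Lemma discrete_wfs1 (C : category) :
  is_wfs (@all_maps C) (capm (@all_maps C) (@is_iso C)).
Proof.
split=> X Y f.
- by split=> // _ A B p [_ pI]; apply: iso_lifts; right.
- split=> [[_ fI] A B i _|fR]; first by apply: iso_lifts; right.
  by split=> //; apply/self_lifts_iso/fR.
- exists Y, f, (idm Y); split; rewrite ?comp1m //; split=> //.
  by exists (idm Y); rewrite comp1m.
Qed.

Lemma discrete_wfs2 (C : category) :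
  is_wfs (capm (@all_maps C) (@is_iso C)) (@all_maps C).
Proof.
split=> X Y f.
- split=> [[_ fI] A B p _|fL]; first by apply: iso_lifts; left.
  by split=> //; apply/self_lifts_iso/fL.
- by split=> // _ A B i [_ iI]; apply: iso_lifts; left.
- exists X, (idm X), f; split; rewrite ?compm1 //; split=> //.
  by exists (idm X); rewrite comp1m.
Qed.

Definition discrete_model (C : category) : model_structure C :=
  ModelStructure (@iso_two_of_three C) (@discrete_wfs1 C) (@discrete_wfs2 C).

(** * Transition systems *)

(* [trans a us b] stands for the tuple (a, u_1, ..., u_n, b), where n >= 1 is
   the length of [us]. *)
Record presystem (Sigma : Type) := Presystem {
  state : Type;
  action : Type;
  label : action -> Sigma;
  trans : state -> seq action -> state -> Prop;
  trans_nonempty : forall a b, ~ trans a [::] b }.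

Record ps_map (Sigma : Type) (X Y : presystem Sigma) := PsMap {
  on_state : state X -> state Y;
  on_action : action X -> action Y;
  on_label : forall u, label (on_action u) = label u;
  on_trans : forall a us b,
    trans a us b -> trans (on_state a) (map on_action us) (on_state b) }.

Lemma ps_map_eq (Sigma : Type) (X Y : presystem Sigma) (f g : ps_map X Y) :
  on_state f = on_state g -> on_action f = on_action g -> f = g.
Proof.
case: f g => [f1 f2 f3 f4] [g1 g2 g3 g4] /= e1 e2; subst g1 g2.
by congr PsMap; apply: Prop_irrelevance.
Qed.

Lemma ps_id_trans (Sigma : Type) (X : presystem Sigma) (a : state X) us b :
  trans a us b -> trans a (map id us) b.
Proof. by rewrite map_id. Qed.

Definition ps_id (Sigma : Type) (X : presystem Sigma) : ps_map X X :=
  @PsMap Sigma X X id id (fun=> erefl) (@ps_id_trans Sigma X).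

Section Comp.
Context (Sigma : Type) (X Y Z : presystem Sigma) (g : ps_map Y Z) (f : ps_map X Y).

Lemma ps_comp_label u : label (on_action g (on_action f u)) = label u.
Proof. by rewrite !on_label. Qed.

Lemma ps_comp_trans a us b : trans a us b ->
  trans (on_state g (on_state f a)) (map (on_action g \o on_action f) us)
    (on_state g (on_state f b)).
Proof. by move=> /(on_trans f)/(on_trans g); rewrite -map_comp. Qed.

Definition ps_comp : ps_map X Z := PsMap ps_comp_label ps_comp_trans.
End Comp.

Definition PTS (Sigma : Type) : category.
Proof.
refine (@Category (presystem Sigma) (@ps_map Sigma) (@ps_id Sigma)
  (@ps_comp Sigma) _ _ _); by move=> *; apply: ps_map_eq.
Defined.

Record is_CSTS (Sigma : Type) (X : presystem Sigma) : Prop := IsCSTS {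
  multiset_axiom : forall (a : state X) (us vs : seq (action X)) (b : state X),
    2 <= size us -> Permutation us vs -> trans a us b -> trans a vs b;
  patching_axiom : forall (a b nu1 nu2 : state X) (us vs ws : seq (action X)),
    1 <= size us -> 1 <= size vs -> 1 <= size ws ->
    trans a (us ++ vs ++ ws) b ->
    trans a us nu1 -> trans nu1 (vs ++ ws) b ->
    trans a (us ++ vs) nu2 -> trans nu2 ws b ->
    trans nu1 vs nu2;
  all_actions_used : forall u : action X,
    exists a b : state X, trans a [:: u] b;
  CSA2_axiom : forall (a b : state X) (us vs : seq (action X)),
    1 <= size us -> 1 <= size vs -> trans a (us ++ vs) b ->
    exists! nu : state X, trans a us nu /\ trans nu vs b;
  CSA1_axiom : forall (a b : state X) (u v : action X),
    trans a [:: u] b -> trans a [:: v] b -> label u = label v -> u = v }.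

Definition CSTS (Sigma : Type) : category := full_sub (C := PTS Sigma) (@is_CSTS Sigma).

(** ** Cofibrations of CSTS *)

Definition no_action (Sigma : Type) (u : void) : Sigma := match u with end.

Definition set_ps (Sigma : Type) (A : Type) : presystem Sigma :=
  @Presystem Sigma A void (@no_action Sigma) (fun _ _ _ => False) (fun _ _ H => H).

(* The action (x_i, i) is represented by its index [i]. *)
Definition cube_trans n (e : {ffun 'I_n -> bool}) (us : seq 'I_n)
    (e' : {ffun 'I_n -> bool}) : Prop :=
  [/\ us != [::], uniq us, (forall i, e i <= e' i)
    & (forall i, (e i != e' i) = (i \in us))].

Lemma cube_nonempty n (e e' : {ffun 'I_n -> bool}) : ~ cube_trans e [::] e'.
Proof. by case. Qed.

Definition cube (Sigma : Type) n (x : n.-tuple Sigma) : presystem Sigma :=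
  @Presystem Sigma {ffun 'I_n -> bool} 'I_n (tnth x) (@cube_trans n)
    (@cube_nonempty n).

(* [{i : 'I_n | 1 < n}] is ['I_n] for n >= 2, and is empty for n = 1, where the
   boundary has no action. *)
Lemma bdcube_nonempty n (e e' : {ffun 'I_n -> bool}) :
  ~ (cube_trans e (map sval ([::] : seq {i : 'I_n | 1 < n})) e' /\ 0 <> n).
Proof. by case=> /cube_nonempty. Qed.

Definition bdcube (Sigma : Type) n (x : n.-tuple Sigma) : presystem Sigma :=
  @Presystem Sigma {ffun 'I_n -> bool} {i : 'I_n | 1 < n}
    (fun u => tnth x (sval u))
    (fun e us e' => cube_trans e (map sval us) e' /\ size us <> n)
    (@bdcube_nonempty n).

Definition bdcube_incl (Sigma : Type) n (x : n.-tuple Sigma) :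
    ps_map (bdcube x) (cube x) :=
  @PsMap Sigma (bdcube x) (cube x) id sval (fun=> erefl) (fun _ _ _ => @proj1 _ _).

Definition C0 (Sigma : Type) : presystem Sigma := cube [tuple of [::]].
Definition C1 (Sigma : Type) (x : Sigma) : presystem Sigma := cube [tuple x].

Section Coproduct.
Context (Sigma : Type) (X Y : presystem Sigma).

Inductive coprod_trans : state X + state Y -> seq (action X + action Y) ->
    state X + state Y -> Prop :=
  | coprod_inl a us b : trans a us b -> coprod_trans (inl a) (map inl us) (inl b)
  | coprod_inr a us b : trans a us b -> coprod_trans (inr a) (map inr us) (inr b).

Lemma coprod_nonempty a b : ~ coprod_trans a [::] b.
Proof.
by move=> H; inversion H as [c [|u us] d t|c [|u us] d t] => //; case: (trans_nonempty t).
Qed.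

Definition coprod : presystem Sigma :=
  @Presystem Sigma (state X + state Y) (action X + action Y)
    (fun u => match u with inl v => label v | inr v => label v end)
    coprod_trans coprod_nonempty.
End Coproduct.

Inductive dbl_state := dbl1 | dbl2 | dbl3 | dbl4.

Inductive dbl_trans : dbl_state -> seq unit -> dbl_state -> Prop :=
  | dbl12 : dbl_trans dbl1 [:: tt] dbl2
  | dbl34 : dbl_trans dbl3 [:: tt] dbl4.

Lemma dbl_nonempty a b : ~ dbl_trans a [::] b.
Proof. by move=> H; inversion H. Qed.

Definition dbl (Sigma : Type) (x : Sigma) : presystem Sigma :=
  @Presystem Sigma dbl_state unit (fun=> x) dbl_trans dbl_nonempty.

Section DblMap.
Context (Sigma : Type) (x : Sigma).

Definition dbl_on_state (a : state (coprod (coprod (C0 Sigma) (C0 Sigma)) (C1 x))) :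
    state (dbl x) :=
  match a with
  | inl (inl _) => dbl1
  | inl (inr _) => dbl2
  | inr e => if e ord0 then dbl4 else dbl3
  end.

Definition dbl_on_action
    (u : action (coprod (coprod (C0 Sigma) (C0 Sigma)) (C1 x))) : action (dbl x) := tt.

Lemma dbl_on_label u : label (dbl_on_action u) = label u.
Proof.
by case: u => [[[]|[]]|i] //=; rewrite (ord1 i).
Qed.

Lemma dbl_on_trans a us b : trans a us b ->
  trans (dbl_on_state a) (map dbl_on_action us) (dbl_on_state b).
Proof.
case=> {}a {}us {}b.
  by case=> {}a {}us {}b [] //; case: us => [|[]].
case=> /= us0 uus le_ab ab; have := ab ord0; have := le_ab ord0.
have -> : us = [:: ord0].
  case: us us0 uus {ab} => [|i [|j us]] // _; first by rewrite (ord1 i).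
  by rewrite (ord1 i) (ord1 j).
by case: (a ord0); case: (b ord0) => //= _ _; apply: dbl34.
Qed.

Definition dbl_map : ps_map (coprod (coprod (C0 Sigma) (C0 Sigma)) (C1 x)) (dbl x) :=
  PsMap dbl_on_label dbl_on_trans.
End DblMap.

Lemma empty_trans (Sigma : Type) (a : void) (us : seq void) (b : void) :
  @trans Sigma (set_ps Sigma void) a us b ->
  @trans Sigma (set_ps Sigma unit) tt (map id us) tt.
Proof. by []. Qed.

Definition empty_map (Sigma : Type) : ps_map (set_ps Sigma void) (set_ps Sigma unit) :=
  @PsMap Sigma (set_ps Sigma void) (set_ps Sigma unit) (fun=> tt) id
    (fun=> erefl) (@empty_trans Sigma).

Inductive gen_cof (Sigma : Type) : morph_class (PTS Sigma) :=
  | gen_point : @gen_cof Sigma (set_ps Sigma void) (set_ps Sigma unit) (empty_map Sigma)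
  | gen_cube n (x : n.-tuple Sigma) : 1 <= n ->
      @gen_cof Sigma (bdcube x) (cube x) (bdcube_incl x)
  | gen_dbl (x : Sigma) :
      @gen_cof Sigma (coprod (coprod (C0 Sigma) (C0 Sigma)) (C1 x)) (dbl x) (dbl_map x).

(* The maps of [gen_cof] are maps of the ambient category [PTS], of which
   [CSTS] is a full subcategory. *)
Definition CSTS_cof (Sigma : Type) : morph_class (CSTS Sigma) :=
  llp (C := CSTS Sigma)
    (fun X Y p => rlp (C := PTS Sigma) (@gen_cof Sigma) (X := sval X) (Y := sval Y) p).

(** ** Star-shaped transition systems *)

Record pointed (Sigma : Type) := Pointed {
  pt_sys :> presystem Sigma;
  base : state pt_sys }.

Record pt_map (Sigma : Type) (X Y : pointed Sigma) := PtMap {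
  pt_ps_map :> ps_map X Y;
  pt_base : on_state pt_ps_map (base X) = base Y }.

Lemma pt_map_eq (Sigma : Type) (X Y : pointed Sigma) (f g : pt_map X Y) :
  pt_ps_map f = pt_ps_map g -> f = g.
Proof.
case: f g => [f1 f2] [g1 g2] /= e; subst g1.
by congr PtMap; apply: Prop_irrelevance.
Qed.

Definition pt_id (Sigma : Type) (X : pointed Sigma) : pt_map X X :=
  @PtMap Sigma X X (ps_id X) erefl.

Lemma pt_comp_base (Sigma : Type) (X Y Z : pointed Sigma)
    (g : pt_map Y Z) (f : pt_map X Y) :
  on_state (ps_comp g f) (base X) = base Z.
Proof. by rewrite /= !pt_base. Qed.

Definition pt_comp (Sigma : Type) (X Y Z : pointed Sigma)
    (g : pt_map Y Z) (f : pt_map X Y) : pt_map X Z :=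
  PtMap (pt_comp_base g f).

Definition PPTS (Sigma : Type) : category.
Proof.
refine (@Category (pointed Sigma) (@pt_map Sigma) (@pt_id Sigma)
  (@pt_comp Sigma) _ _ _); by move=> *; apply/pt_map_eq/ps_map_eq.
Defined.

Definition path_trans n (i : 'I_n.+1) (us : seq 'I_n) (j : 'I_n.+1) : Prop :=
  exists k : 'I_n, [/\ i = k :> nat, us = [:: k] & j = k.+1 :> nat].

Lemma path_nonempty n (i j : 'I_n.+1) : ~ path_trans i [::] j.
Proof. by case=> k []. Qed.

Definition path_ps (Sigma : Type) n (w : n.-tuple Sigma) : pointed Sigma :=
  @Pointed Sigma
    (@Presystem Sigma 'I_n.+1 'I_n (tnth w) (@path_trans n) (@path_nonempty n)) ord0.

Definition path_end (Sigma : Type) (X : pointed Sigma) n (w : n.-tuple Sigma)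
    (f : pt_map (path_ps w) X) : state X :=
  on_state f (ord_max : 'I_n.+1).

Definition star_shaped (Sigma : Type) (X : pointed Sigma) :=
  forall a : state X, exists (n : nat) (w : n.-tuple Sigma)
    (f : pt_map (path_ps w) X), path_end f = a.

(* The category CSTS_\bullet. *)
Definition StarCSTS (Sigma : Type) : category :=
  full_sub (C := PPTS Sigma) (fun X => is_CSTS X /\ star_shaped X).

Definition underlying (Sigma : Type) (X : StarCSTS Sigma) : CSTS Sigma :=
  exist _ (pt_sys (sval X)) (proj1 (svalP X)).

Definition underlying_map (Sigma : Type) (X Y : StarCSTS Sigma) (f : hom X Y) :
    hom (underlying X) (underlying Y) :=
  pt_ps_map (f : pt_map (sval X) (sval Y)).

Definition StarCSTS_cof (Sigma : Type) : morph_class (StarCSTS Sigma) :=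
  fun X Y f => CSTS_cof (underlying_map f).

(** ** Cylinder, homotopy and past-similarity *)

Definition internal (Sigma : Type) (X : pointed Sigma) (a : state X) : Prop :=
  a = base X \/
  exists (c d : state X) (us vs : seq (action X)),
    [/\ trans c (us ++ vs) d, trans c us a & trans a vs d].

Definition external (Sigma : Type) (X : pointed Sigma) (a : state X) := ~ internal a.

Section Cylinder.
Context (Sigma : Type) (X : pointed Sigma).

(* A state is a pair (a, e), where e = 1 is allowed only if a is external. *)
Definition cyl_state := {p : state X * bool | p.2 -> external p.1}.

Definition cyl_proj (p : cyl_state) : state X := (sval p).1.

Lemma cyl_inP (e : bool) (a : state X) :
  (a, e && `[< external a >]).2 -> external (a, e && `[< external a >]).1.
Proof. by case/andP=> _ /asboolP. Qed.

Definition cyl_in (e : bool) (a : state X) : cyl_state :=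
  exist (fun p : state X * bool => p.2 -> external p.1) _ (@cyl_inP e a).

Definition cyl : pointed Sigma :=
  @Pointed Sigma
    (@Presystem Sigma cyl_state (action X) (@label Sigma X)
       (fun a us b => trans (cyl_proj a) us (cyl_proj b))
       (fun a b => @trans_nonempty Sigma X (cyl_proj a) (cyl_proj b)))
    (cyl_in false (base X)).

Lemma cyl_gamma_trans (e : bool) (a : state X) us (b : state X) :
  trans a us b -> @trans Sigma cyl (cyl_in e a) (map id us) (cyl_in e b).
Proof. by rewrite map_id. Qed.

Lemma cyl_gamma_base (e : bool) : cyl_in e (base X) = cyl_in false (base X).
Proof.
have -> // : cyl_in e (base X) = cyl_in false (base X).
apply: eq_exist => /=; congr pair.
by apply/negP => /andP[_ /asboolP]; apply; left.
Qed.

Definition cyl_gamma (e : bool) : pt_map X cyl :=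
  @PtMap Sigma X cyl
    (@PsMap Sigma X cyl (cyl_in e) id (fun=> erefl) (@cyl_gamma_trans e))
    (cyl_gamma_base e).
End Cylinder.

Definition homotopic (Sigma : Type) (X Y : pointed Sigma) (f g : pt_map X Y) :=
  exists H : pt_map (cyl X) Y,
    pt_comp H (cyl_gamma X false) = f /\ pt_comp H (cyl_gamma X true) = g.

Definition past_similar (Sigma : Type) (X : pointed Sigma) (a b : state X) :=
  exists (n : nat) (w : n.-tuple Sigma) (f g : pt_map (path_ps w) X),
    [/\ homotopic f g, path_end f = a & path_end g = b].

Definition reduced (Sigma : Type) (X : pointed Sigma) :=
  forall a b : state X, past_similar a b <-> a = b.

Definition is_reduced (Sigma : Type) (X : StarCSTS Sigma) := reduced (sval X).

Definition RedStarCSTS (Sigma : Type) : category :=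
  full_sub (C := StarCSTS Sigma) (@is_reduced Sigma).

Definition red_inclusion (Sigma : Type) : functor (RedStarCSTS Sigma) (StarCSTS Sigma) :=
  inclusion (C := StarCSTS Sigma) (@is_reduced Sigma).

Definition StarCSTS_model (Sigma : Type) (M : model_structure (StarCSTS Sigma)) :=
  (forall (X Y : StarCSTS Sigma) (f : hom X Y), cof M f <-> StarCSTS_cof f) /\
  left_determined M.

(* Main.v *)
(**
Trivial fibrations of CSTS are exactly the blow-ups, that is, the maps that are
bijective on actions, surjective on states, and reflect transitions. Filling
cubes one dimension at a time gives reflection, and CSA1 gives injectivity on
actions. Consequently a map is a cofibration as soon as it identifies only
states that are intermediate in the target, where CSA2 makes the fibres of
blow-ups trivial. The same description of trivial fibrations holds in the
star-shaped category.

Call two states interchangeable if they have the same incoming and outgoing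
transitions. Interchangeable states are past-similar, so reduced objects are
orthogonal to blow-ups; the class of maps to which they are orthogonal is closed
under all the operations defining the left determined weak equivalences, and
hence contains them. Conversely, if [Z] is fibrant, past-similar states of [Z]
are interchangeable: both projections to [Z] of a path object of [Z] are
blow-ups with a common section, and a homotopy of paths lifts to it. So [Z]
modulo past-similarity is reduced and the quotient map is a blow-up; composed
with a fibrant replacement it yields a weak equivalence from any object to a
reduced one. The rest is formal.
*)
Require Import Defs.
From mathcomp Require Import all_boot boolp classical_sets functions cardinality.
From Stdlib Require Import Permutation.

Set Implicit Arguments.
Unset Strict Implicit.
Unset Printing Implicit Defensive.

Local Open Scope cat_scope.

(** * Transitions and cubes *)

Lemma perm_eq_Permutation (T : eqType) (s t : seq T) : perm_eq s t -> Permutation s t.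
Proof.
elim: s t => [|x s IH] t st.
  by move/perm_size: st; case: t => // _; constructor.
have xt : x \in t by rewrite -(perm_mem st) mem_head.
case/splitPr: xt st => t1 t2 st; apply: Permutation_cons_app; apply: IH.
by rewrite -(perm_cons x) (seq.perm_trans st) // -cat1s perm_catCA.
Qed.

Section Transitions.
Context (Sigma : Type) (X : presystem Sigma).
Implicit Types (a b c : state X) (us vs ws : seq (action X)).

Lemma trans_size a us b : trans a us b -> 0 < size us.
Proof. by case: us => // /trans_nonempty. Qed.

(** Empty sequences are allowed so that the extreme vertices of a cube and the degenerate cases of
    patching need no separate treatment. *)
Definition trans0 a us b := (us = [::] /\ a = b) \/ trans a us b.

Lemma trans0_nil a b : trans0 a [::] b -> a = b.
Proof. by case=> [[]|/trans_nonempty]. Qed.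

Lemma trans0_trans a us b : 0 < size us -> trans0 a us b -> trans a us b.
Proof. by move=> us0 [[us1 _]|//]; rewrite us1 in us0. Qed.

(** The second clause of [internal], available without a base state; both pieces are nonempty
    because transitions are. *)
Definition middle a := exists c d us vs,
  [/\ trans c (us ++ vs) d, trans c us a & trans a vs d].

Context (XC : is_CSTS X).

(** Indexing by an [eqType] gives boolean permutations although actions have no decidable equality.
    Sequences of length at most one, outside the multiset axiom, have only the trivial
    permutation. *)
Lemma trans_perm (I : eqType) (f : I -> action X) (s t : seq I) a b :
  perm_eq s t -> trans a (map f s) b -> trans a (map f t) b.
Proof.
move=> st; have [s2|] := leqP 2 (size s).
  apply: (multiset_axiom XC); first by rewrite size_map.
  exact/Permutation_map/perm_eq_Permutation.
by rewrite ltnS => s1; rewrite (perm_small_eq _ st) // -(perm_size st).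
Qed.

Lemma trans0_perm (I : eqType) (f : I -> action X) (s t : seq I) a b :
  perm_eq s t -> trans0 a (map f s) b -> trans0 a (map f t) b.
Proof.
move=> st [[s0 ->]|/trans_perm]; last by move/(_ _ st); right.
by left; split=> //; move/perm_size: st; case: s s0 => //; case: t.
Qed.

Lemma trans0_split a us vs b : trans a (us ++ vs) b ->
  exists c, trans0 a us c /\ trans0 c vs b.
Proof.
case: us vs => [|u us] [|v vs] T.
- by exists a; split; [left|left; case: (trans_nonempty T)].
- by exists a; split; [left|right].
- by exists b; rewrite cats0 in T; split; [right|left].
by have [c [[Tc cT] _]] := CSA2_axiom XC (isT : 0 < size (u :: us)) (isT : 0 < size (v :: vs)) T;
  exists c; split; right.
Qed.

Lemma middle_unique c d us vs a b : trans c (us ++ vs) d ->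
  trans c us a -> trans a vs d -> trans c us b -> trans b vs d -> a = b.
Proof.
move=> T ca ad cb bd.
have [e [_ eU]] := CSA2_axiom XC (trans_size ca) (trans_size ad) T.
by rewrite -(eU a) // -(eU b).
Qed.

Lemma trans0_patch a b c d us vs ws : 0 < size vs -> trans a (us ++ vs ++ ws) b ->
  trans0 a us c -> trans0 c (vs ++ ws) b -> trans0 a (us ++ vs) d -> trans0 d ws b ->
  trans c vs d.
Proof.
move=> vs0 T ac cb ad db; case: us T ac ad => [|u us] T ac ad.
  by rewrite -(trans0_nil ac); apply: trans0_trans.
case: ws T cb db => [|w ws] T cb db.
  by rewrite (trans0_nil db); rewrite cats0 in cb; apply: trans0_trans.
have [cb' ad'] : trans c (vs ++ w :: ws) b /\ trans a ((u :: us) ++ vs) d.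
  by split; apply: trans0_trans => //; rewrite size_cat // addnS.
by apply: (patching_axiom XC _ _ _ T) => //; apply: trans0_trans.
Qed.

End Transitions.

(** * Cubes filled by a single transition *)

Section CubeMap.
Context (Sigma : Type) (Y : presystem Sigma) (YC : is_CSTS Y) (n : nat).
Context (f : 'I_n -> action Y) (a b : state Y).
Context (T : trans a (map f (enum 'I_n)) b).

(** The vertex [e] comes from CSA2, splitting the transition into the directions selected by [e]
    followed by the others. A face from [e] to [e'] is the middle block of a splitting into three,
    hence is given by patching. *)
Lemma cube_vertices : exists nu : {ffun 'I_n -> bool} -> state Y,
  [/\ nu [ffun=> false] = a, nu [ffun=> true] = b
    & forall e us e', cube_trans e us e' -> trans (nu e) (map f us) (nu e')].
Proof.
pose S (e : {ffun 'I_n -> bool}) := [seq i <- enum 'I_n | e i].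
pose S' (e : {ffun 'I_n -> bool}) := [seq i <- enum 'I_n | ~~ e i].
have mS e i : (i \in S e) = e i by rewrite mem_filter mem_enum andbT.
have mS' e i : (i \in S' e) = ~~ e i by rewrite mem_filter mem_enum andbT.
have uS e : uniq (S e) by rewrite filter_uniq // enum_uniq.
have uS' e : uniq (S' e) by rewrite filter_uniq // enum_uniq.
have /choice[nu nuP] e : exists c, trans0 a (map f (S e)) c /\ trans0 c (map f (S' e)) b.
  apply: (trans0_split YC); rewrite -map_cat; apply: (trans_perm YC) T.
  by rewrite perm_sym (permEl (perm_filterC e _)).
exists nu; split.
- have [] := nuP [ffun=> false]; rewrite (_ : S _ = [::]) => [/trans0_nil //|].
  by apply/eqP; rewrite -(negbK (_ == _)) -has_filter; apply/hasPn => i _; rewrite ffunE.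
- have [_] := nuP [ffun=> true]; rewrite (_ : S' _ = [::]) => [/trans0_nil //|].
  by apply/eqP; rewrite -(negbK (_ == _)) -has_filter; apply/hasPn => i _; rewrite ffunE.
move=> e us e' [us0 uus le_ee' ee'].
have eus i : i \in us = ~~ e i && e' i.
  by rewrite -ee'; have := le_ee' i; case: (e i) (e' i) => -[].
have [ae eb] := nuP e; have [ae' e'b] := nuP e'.
have uSu : uniq (S e ++ us).
  rewrite cat_uniq uS uus andbT /=; apply/hasPn => i.
  by rewrite eus mS => /andP[].
have uuS' : uniq (us ++ S' e').
  rewrite cat_uniq uus uS' andbT /=; apply/hasPn => i.
  by rewrite mS' eus negb_and => ->; rewrite orbT.
have uA : uniq (S e ++ us ++ S' e').
  rewrite cat_uniq uS uuS' andbT /=; apply/hasPn => i.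
  rewrite mem_cat eus mS' mS; have := le_ee' i.
  by case: (e i) (e' i) => -[].
apply: (@trans0_patch _ _ YC a b _ _ (map f (S e)) _ (map f (S' e'))) => //.
- by case: (us) us0.
- rewrite -!map_cat; apply: (trans_perm YC) T; apply: uniq_perm => // [|i].
    exact: enum_uniq.
  rewrite !mem_cat mem_enum eus mS' mS; have := le_ee' i.
  by case: (e i) (e' i) => -[].
- rewrite -map_cat; apply: (trans0_perm YC) eb; apply: uniq_perm => // i.
  rewrite mem_cat eus !mS'; have := le_ee' i.
  by case: (e i) (e' i) => -[].
- rewrite -map_cat; apply: (trans0_perm YC) ae'; apply: uniq_perm => // i.
  rewrite mem_cat eus !mS; have := le_ee' i.
  by case: (e i) (e' i) => -[].
Qed.

End CubeMap.

(** * Trivial fibrations and cofibrations of CSTS *)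

Lemma ps_map_congr (Sigma : Type) (X Y : presystem Sigma) (f g : ps_map X Y) :
  f = g -> on_state f =1 on_state g /\ on_action f =1 on_action g.
Proof. by move=> ->. Qed.

Record blowup (Sigma : Type) (X Y : presystem Sigma) (p : ps_map X Y) : Prop := Blowup {
  blowup_state : forall y, exists x, on_state p x = y;
  blowup_inj : injective (on_action p);
  blowup_action : forall v, exists u, on_action p u = v;
  blowup_trans : forall a us b,
    trans (on_state p a) (map (on_action p) us) (on_state p b) -> trans a us b }.

(** The transition through the middle state is reflected to [X], where [a] and [b] both split it at
    the same place; CSA2 makes such a state unique. *)
Lemma blowup_middle (Sigma : Type) (X Y : presystem Sigma) (p : ps_map X Y) a b :
  is_CSTS X -> blowup p -> on_state p a = on_state p b ->
  middle (on_state p a) -> a = b.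
Proof.
move=> XC pB pab [c' [d' [us' [vs' [T ca ad]]]]].
have [[c pc] [d pd]] := (blowup_state pB c', blowup_state pB d').
have lift_seq : forall ws', exists ws, map (on_action p) ws = ws'.
  elim=> [|w' ws' [ws <-]]; first by exists [::].
  by have [w <-] := blowup_action pB w'; exists (w :: ws).
have [[us pus] [vs pvs]] := (lift_seq us', lift_seq vs').
subst c' d' us' vs'.
apply: (middle_unique XC (c := c) (d := d) (us := us) (vs := vs)); apply: (blowup_trans pB);
  rewrite ?map_cat // -pab //.
Qed.

Lemma cube1_trans (e : {ffun 'I_1 -> bool}) us e' : cube_trans e us e' ->
  [/\ us = [:: ord0], e ord0 = false & e' ord0 = true].
Proof.
case=> us0 uus le_ee' ee'.
have us1 : us = [:: ord0].
  case: us us0 uus {ee'} => [|i [|j us]] // _; first by rewrite (ord1 i).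
  by rewrite (ord1 i) (ord1 j).
have := ee' ord0; have := le_ee' ord0; rewrite us1 mem_head.
by case: (e _) (e' _) => -[].
Qed.

Section Edge.
Context (Sigma : Type) (Z : presystem Sigma) (a b : state Z) (u : action Z) (T : trans a [:: u] b).

Definition edge_state (e : {ffun 'I_1 -> bool}) := if e ord0 then b else a.

Lemma edge_on_label (i : 'I_1) : label u = tnth [tuple label u] i.
Proof. by rewrite (ord1 i). Qed.

Lemma edge_on_trans e us e' : cube_trans e us e' ->
  trans (edge_state e) (map (fun=> u) us) (edge_state e').
Proof. by move=> /cube1_trans[-> e0 e1]; rewrite /edge_state e0 e1. Qed.

Definition edge : ps_map (C1 (label u)) Z :=
  @PsMap Sigma (C1 (label u)) Z edge_state (fun=> u) edge_on_label edge_on_trans.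
End Edge.

Section TrivialFibrations.
Context (Sigma : Type) (X Y : presystem Sigma) (XC : is_CSTS X) (YC : is_CSTS Y).
Context (p : ps_map X Y).
Context (pR : rlp (C := PTS Sigma) (@gen_cof Sigma) (X := X) (Y := Y) p).

Lemma rlp_state y : exists x, on_state p x = y.
Proof.
pose a : ps_map (set_ps Sigma void) X := @PsMap Sigma (set_ps Sigma void) X
  (fun v => match v with end) (fun v => match v with end)
  (fun v => match v with end) (fun v => match v with end).
pose b : ps_map (set_ps Sigma unit) Y := @PsMap Sigma (set_ps Sigma unit) Y
  (fun=> y) (fun v => match v with end)
  (fun v => match v with end) (fun _ _ _ H => match H with end).
have [|h [_ ph]] := pR (gen_point Sigma) (a := a) (b := b).
  by apply: ps_map_eq; apply: funext => -[].
by exists (on_state h tt); have [phs _] := ps_map_congr ph; apply: (phs tt).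
Qed.

Lemma rlp_edge a v b : trans (on_state p a) [:: v] (on_state p b) ->
  exists u, on_action p u = v /\ trans a [:: u] b.
Proof.
move=> T; pose x := [tuple label v].
have absurd (i : {i : 'I_1 | 1 < 1}) : False by case: i.
have Tb e us e' : @trans _ (bdcube x) e us e' ->
    trans (edge_state a b e)
      (map (fun i => match absurd i return action X with end) us) (edge_state a b e').
  by case: us => [[/cube_nonempty]|u]; [|case: (absurd u)].
pose f : ps_map (bdcube x) X := @PsMap Sigma (bdcube x) X (edge_state a b)
  (fun i => match absurd i with end) (fun i => match absurd i with end) Tb.
have [|h [hf ph]] := pR (gen_cube x isT) (a := f) (b := edge T).
  apply: ps_map_eq; apply: funext => e; last by case: (absurd e).
  by rewrite /= /edge_state; case: (e _).
exists (on_action h ord0); have [_ pha] := ps_map_congr ph; split; first exact: (pha ord0).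
have [hs _] := ps_map_congr hf.
have := hs [ffun=> false]; have := hs [ffun=> true].
rewrite /= /edge_state !ffunE => <- <-.
apply: (on_trans h (us := [:: ord0])); split=> // i; rewrite !ffunE //.
by rewrite (ord1 i).
Qed.

(** Lifting against [dbl_map]: its second edge is sent to some transition carrying [u], which exists
    because all actions are used. This forces the shared action of [dbl] to go to [u] itself, not to
    another action with the same image. *)
Lemma rlp_trans1 a u b :
  trans (on_state p a) [:: on_action p u] (on_state p b) -> trans a [:: u] b.
Proof.
move=> T; have [c [d cd]] := all_actions_used XC u.
pose src := coprod (coprod (C0 Sigma) (C0 Sigma)) (C1 (label u)).
pose fs (s : state src) := match s with
  | inl (inl _) => a | inl (inr _) => b | inr e => edge_state c d e end.
pose fa (i : action src) := u.
have fl i : label (fa i) = label i.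
  by case: i => [[[]|[]]|i] //=; rewrite (ord1 i).
have ft s us t : trans s us t -> trans (fs s) (map fa us) (fs t).
  case=> {}s {}us {}t.
    by case=> {}s {}us {}t [] //; case: us => [|[]].
  by move=> /cube1_trans[-> e0 e1]; rewrite /= /edge_state e0 e1.
pose f : ps_map src X := PsMap fl ft.
pose gs (s : dbl_state) := match s with
  | dbl1 => on_state p a | dbl2 => on_state p b
  | dbl3 => on_state p c | dbl4 => on_state p d end.
have gt s us t : @trans _ (dbl (label u)) s us t ->
    trans (gs s) (map (fun=> on_action p u) us) (gs t).
  by case=> //=; apply: (on_trans p (us := [:: u])).
pose g : ps_map (dbl (label u)) Y := @PsMap Sigma (dbl (label u)) Y gs
  (fun=> on_action p u) (fun=> on_label p u) gt.
have [|h [hf _]] := pR (gen_dbl (label u)) (a := f) (b := g).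
  apply: ps_map_eq; apply: funext => //= -[[]|e] //.
  by rewrite /= /edge_state; case: (e _).
have [hs ha] := ps_map_congr hf.
have ha1 : on_state h dbl1 = a := hs (inl (inl [ffun=> false])).
have hb2 : on_state h dbl2 = b := hs (inl (inr [ffun=> false])).
have hu : on_action h tt = u := ha (inr ord0).
by have := on_trans h dbl12; rewrite /= ha1 hb2 hu.
Qed.

(** A transition by [u] is reflected to one by [v] with the same ends, so CSA1 applies. *)
Lemma rlp_inj : injective (on_action p).
Proof.
move=> u v puv; have [c [d cd]] := all_actions_used XC u.
have cvd : trans c [:: v] d.
  by apply: rlp_trans1; rewrite -puv; apply: (on_trans p (us := [:: u])).
by apply: (CSA1_axiom XC cd cvd); rewrite -(on_label p u) puv on_label.
Qed.

Lemma rlp_action v : exists u, on_action p u = v.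
Proof.
have [c' [d' T]] := all_actions_used YC v.
have [[c pc] [d pd]] := (rlp_state c', rlp_state d').
by move: T; rewrite -pc -pd => /rlp_edge[u [pu _]]; exists u.
Qed.

Lemma rlp_trans a us b :
  trans (on_state p a) (map (on_action p) us) (on_state p b) -> trans a us b.
Proof.
move: {2}(size us).+1 (ltnSn (size us)) => m; elim: m => // m IH in a us b *.
rewrite ltnS => usm T; pose n := size us.
have [us2|] := ltnP 1 n; last first.
  have := trans_size T; rewrite size_map {}/n.
  by case: us T {usm} => [|u [|]] // /rlp_trans1.
pose g := tnth (in_tuple us).
have gE : map g (enum 'I_n) = us by rewrite map_tnth_enum.
have [|nu [nu0 nu1 nuT]] := cube_vertices YC (n := n) (f := on_action p \o g)
    (a := on_state p a) (b := on_state p b).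
  by rewrite map_comp gE.
pose x : n.-tuple Sigma := [tuple of map (@label _ X) (in_tuple us)].
have xE i : label (g i) = tnth x i by rewrite tnth_map.
have /choice[s0 s0P] : forall e, exists s, on_state p s = nu e.
  by move=> e; apply: rlp_state.
(* The extreme vertices must be the given [a] and [b]; every other vertex may be any preimage. *)
pose s e := if e == [ffun=> false] then a else if e == [ffun=> true] then b else s0 e.
have sP e : on_state p (s e) = nu e.
  rewrite /s; case: eqP => [->//|_]; case: eqP => [->//|_]; exact: s0P.
have ft e vs e' : @trans _ (bdcube x) e vs e' ->
    trans (s e) (map (g \o sval) vs) (s e').
  (* A transition of the boundary uses fewer than [n] directions, so the induction hypothesis
     reflects it. *)
  move=> [C vsn]; apply: IH.
    rewrite size_map (leq_trans _ usm) // ltn_neqAle; apply/andP; split; first exact/eqP.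
    have [_ uvs _ _] := C.
    by move/card_uniqP: uvs; rewrite size_map => <-; rewrite -[X in _ <= X]card_ord max_card.
  by rewrite !sP -map_comp compA map_comp; apply: nuT.
pose f : ps_map (bdcube x) X := @PsMap Sigma (bdcube x) X s (g \o sval)
  (fun i => xE (sval i)) ft.
pose h' : ps_map (cube x) Y := @PsMap Sigma (cube x) Y nu (on_action p \o g)
  (fun i => etrans (on_label p (g i)) (xE i)) nuT.
have [|h [hf _]] := pR (gen_cube x (ltnW us2)) (a := f) (b := h').
  by apply: ps_map_eq; apply: funext => //= e; rewrite sP.
have [hs ha] := ps_map_congr hf.
have /= := hs [ffun=> false]; have /= := hs [ffun=> true].
rewrite /s !eqxx; case: eqP => [/ffunP/(_ (Ordinal (ltnW us2)))|_].
  by rewrite !ffunE.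
move=> <- <-; rewrite -[us]gE.
have -> : map g (enum 'I_n) = map (on_action h) (enum 'I_n).
  by apply: eq_map => i; apply/esym; apply: (ha (exist (fun=> 1 < n) i us2)).
apply: on_trans; split=> [||i|i]; rewrite ?enum_uniq ?ffunE ?mem_enum //.
by rewrite -size_eq0 size_enum_ord -lt0n (ltnW us2).
Qed.

Lemma rlp_blowup : blowup p.
Proof. by split; [apply: rlp_state|apply: rlp_inj|apply: rlp_action|apply: rlp_trans]. Qed.

End TrivialFibrations.

(** On the image of [i] the lift is dictated by [a], consistently by the second hypothesis;
    elsewhere any preimage under [p] will do. Transitions are then obtained by reflection. *)
Lemma lifts_blowup (Sigma : Type) (A B X Y : presystem Sigma) (i : ps_map A B)
    (p : ps_map X Y) : blowup p ->
  (forall (a : ps_map A X) (b : ps_map B Y), ps_comp p a = ps_comp b i ->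
     forall x y, on_state i x = on_state i y -> on_state a x = on_state a y) ->
  lifts (C := PTS Sigma) i p.
Proof.
move=> pB iP a b pabi; have [pas paa] := ps_map_congr pabi.
have /choice[hs hsP] t : exists s, on_state p s = on_state b t /\
    forall x, on_state i x = t -> s = on_state a x.
  have [[x <-]|nx] := pselect (exists x, on_state i x = t).
    by exists (on_state a x); split=> [|y /esym]; [apply: pas|apply: iP pabi _ _].
  have [s ps] := blowup_state pB (on_state b t).
  by exists s; split=> // x ix; case: nx; exists x.
have /choice[ha haP] v : exists u, on_action p u = on_action b v.
  exact: (blowup_action pB).
have hl v : label (ha v) = label v by rewrite -(on_label p) haP on_label.
have ht s us t : trans s us t -> trans (hs s) (map ha us) (hs t).
  move=> T; apply: (blowup_trans pB).
  rewrite (hsP s).1 (hsP t).1 -map_comp (eq_map (_ : on_action p \o ha =1 on_action b)) //.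
  exact: on_trans.
exists (PsMap hl ht); split; apply: ps_map_eq; apply: funext => x //=.
- exact: (hsP _).2.
- by apply: (blowup_inj pB); rewrite haP; apply/esym/paa.
- by case: (hsP x).
Qed.

Lemma gen_cof_inj (Sigma : Type) (A B : PTS Sigma) (i : hom A B) :
  gen_cof i -> injective (on_state (i : ps_map A B)).
Proof.
have C0E (e e' : {ffun 'I_0 -> bool}) : e = e' by apply/ffunP => -[].
have C1E (e e' : {ffun 'I_1 -> bool}) : e ord0 = e' ord0 -> e = e'.
  by move=> ee'; apply/ffunP => k; rewrite (ord1 k).
case=> [|n x _|x] => [[]||] //= [[e|e]|e] [[e'|e']|e'] //=;
  rewrite ?(C0E e e') //; case: ifP => // Ee; case: ifP => // Ee' _;
  by rewrite (C1E e e') // Ee Ee'.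
Qed.

Lemma blowup_rlp (Sigma : Type) (X Y : presystem Sigma) (p : ps_map X Y) :
  blowup p -> rlp (C := PTS Sigma) (@gen_cof Sigma) (X := X) (Y := Y) p.
Proof.
move=> pB A B i iG; apply: lifts_blowup => // a b _ x y ixy.
by rewrite (gen_cof_inj iG ixy).
Qed.

Lemma CSTS_cofI (Sigma : Type) (A B : CSTS Sigma) (i : hom A B) :
  (forall x y, on_state (i : ps_map (sval A) (sval B)) x = on_state (i : ps_map _ _) y ->
     x = y \/ middle (on_state (i : ps_map _ _) x)) ->
  CSTS_cof i.
Proof.
move=> iP X Y p pR; have pB := rlp_blowup (svalP X) (svalP Y) pR.
apply: (lifts_blowup pB) => a b pabi x y ixy.
have [->//|[c [d [us [vs [T ca ad]]]]]] := iP x y ixy.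
have [pas _] := ps_map_congr pabi.
apply: (blowup_middle (svalP X) pB); first by rewrite [LHS]pas [RHS]pas /= ixy.
have -> : on_state (p : ps_map _ _) (on_state a x) = on_state b (on_state (i : ps_map _ _) x).
  exact: pas.
exists (on_state b c), (on_state b d), (map (on_action b) us), (map (on_action b) vs).
by rewrite -map_cat; split; apply: on_trans.
Qed.

(** * Star-shaped transition systems *)

(** An inductive form of being the end of a path, which replaces maps out of paths by inductions. *)
Inductive reach (Sigma : Type) (X : pointed Sigma) : state X -> Prop :=
  | reach_base : reach (base X)
  | reach_step a u b : reach a -> trans a [:: u] b -> reach b.

Lemma reach_map (Sigma : Type) (X Y : pointed Sigma) (f : pt_map X Y) a :
  reach a -> reach (on_state f a).
Proof.
elim=> [|{}a u b _ IH /(on_trans f) T]; first by rewrite pt_base; apply: reach_base.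
exact: reach_step IH T.
Qed.

Section Reach.
Context (Sigma : Type) (X : pointed Sigma).

Section PathMap.
Context (n : nat) (s : nat -> state X) (u : 'I_n -> action X).
Context (s0 : s 0 = base X) (su : forall k : 'I_n, trans (s k) [:: u k] (s k.+1)).

Definition path_word : n.-tuple Sigma := [tuple label (u k) | k < n].

Lemma path_on_label k : label (u k) = tnth path_word k.
Proof. by rewrite tnth_mktuple. Qed.

Lemma path_on_trans (i : 'I_n.+1) us (j : 'I_n.+1) : path_trans i us j ->
  trans (s i) (map u us) (s j).
Proof. by case=> k [-> -> ->]; apply: su. Qed.

Definition path_map : pt_map (path_ps path_word) X :=
  @PtMap _ (path_ps path_word) X (@PsMap Sigma (path_ps path_word) X
    (fun i : 'I_n.+1 => s i) u path_on_label path_on_trans) s0.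
End PathMap.

Lemma reach_path a : reach a -> exists n (s : nat -> state X) (u : 'I_n -> action X),
  [/\ s 0 = base X, forall k : 'I_n, trans (s k) [:: u k] (s k.+1) & s n = a].
Proof.
elim=> [|{}a v b _ [n [s [u [s0 su sn]]]] T].
  have no k : k < 0 -> False by [].
  by exists 0, (fun=> base X), (fun k => match no _ (ltn_ord k) with end); split=> // -[] //.
(* The new state sits at index [n.+1]; [insub] recovers the old steps [k < n], and its failure at
   [k = n] yields the new action [v]. *)
exists n.+1, (fun k => if k == n.+1 then b else s k), (fun k => oapp u v (insub (val k))).
split=> [//|k|]; last by rewrite eqxx.
rewrite (ltn_eqF (ltn_ord k)) eqSS; have := ltn_ord k; rewrite ltnS leq_eqVlt /=.
case: eqP => [->|_ /= kn]; last by rewrite insubT; apply: (su (Ordinal kn)).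
by rewrite insubF ?ltnn // sn.
Qed.

Lemma star_reachP (a : state X) : (exists (n : nat) (w : n.-tuple Sigma)
  (f : pt_map (path_ps w) X), path_end f = a) <-> reach a.
Proof.
split=> [[n [w [f <-]]]|/reach_path[n [s [u [s0 su <-]]]]]; last first.
  by exists n, (path_word u), (path_map s0 su).
apply: (@reach_map _ (path_ps w) X); move: (ord_max : 'I_n.+1) => -[i].
elim: i => [|i IH] iP.
  by rewrite (_ : Ordinal iP = ord0) //; [apply: (@reach_base _ (path_ps w))|apply: val_inj].
apply: (@reach_step _ (path_ps w) _ (Ordinal (iP : i < n)) _ (IH (ltnW iP))).
by exists (Ordinal (iP : i < n)).
Qed.

Lemma star_reach : star_shaped X <-> forall a : state X, reach a.
Proof. by split=> H a; apply/star_reachP. Qed.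

End Reach.

Lemma star_image (Sigma : Type) (X Y : pointed Sigma) (f : pt_map X Y) :
  (forall y, exists x, on_state f x = y) -> star_shaped X -> star_shaped Y.
Proof.
move=> fs /star_reach XS; apply/star_reach => y; have [x <-] := fs y.
exact/reach_map.
Qed.

(** * Transitions pulled back along a map of states *)

Section Pull.
Context (Sigma : Type) (Y : presystem Sigma) (T : Type) (q : T -> state Y).

Definition pull : presystem Sigma := @Presystem Sigma T (action Y) (@label _ Y)
  (fun a us b => trans (q a) us (q b)) (fun a b => @trans_nonempty _ Y (q a) (q b)).

Lemma pull_on_trans (a : T) us b : @trans _ pull a us b -> trans (q a) (map id us) (q b).
Proof. by rewrite map_id. Qed.

Definition pull_proj : ps_map pull Y :=
  @PsMap Sigma pull Y q id (fun=> erefl) pull_on_trans.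

(** Uniqueness in CSA2 requires one-point fibres over middle states, and the last hypothesis keeps
    every action used; the other axioms pull back directly. The cylinder and the quotients below are
    instances. *)
Lemma pull_CSTS : is_CSTS Y ->
  (forall a, middle a -> exists! t, q t = a) ->
  (forall u, exists t t', trans (q t) [:: u] (q t')) -> is_CSTS pull.
Proof.
move=> YC qm qu; split=> //.
- by move=> a us vs b; apply: (multiset_axiom YC).
- by move=> a b c d us vs ws; apply: (patching_axiom YC).
- move=> a b us vs us0 vs0 T1.
  have [c [[ac cb] cU]] := CSA2_axiom YC us0 vs0 T1.
  have [|t [qt tU]] := qm c; first by exists (q a), (q b), us, vs.
  exists t; split=> [|t' [at' tb']]; first by rewrite /= qt.
  by apply: tU; rewrite (cU (q t')).
- by move=> a b u v; apply: (CSA1_axiom YC).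
Qed.
End Pull.

Lemma path_CSTS (Sigma : Type) n (w : n.-tuple Sigma) : is_CSTS (path_ps w).
Proof.
split=> /=.
- by move=> a us vs b + _ [k [_ us1 _]]; rewrite us1.
- move=> a b c d us vs ws us0 vs0 ws0 [k [_ + _]].
  by case: us us0 => [|i [|]] //=; case: vs vs0.
- move=> u; exists (widen_ord (leqnSn n) u), (lift ord0 u), u.
  by split=> //; rewrite /= /bump.
- move=> a b us vs us0 vs0 [k [_ + _]].
  by case: us us0 => [|i [|]] //=; case: vs vs0.
- by move=> a b u v [k [ak [->] _]] [l [al [->] _]] _; apply: ord_inj; rewrite -ak al.
Qed.

Lemma path_star (Sigma : Type) n (w : n.-tuple Sigma) : star_shaped (path_ps w).
Proof.
apply/star_reach => -[i]; elim: i => [|i IH] iP.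
  by rewrite (_ : Ordinal iP = ord0) //; [apply: (@reach_base _ (path_ps w))|apply: val_inj].
apply: (@reach_step _ (path_ps w) _ (Ordinal (iP : i < n)) _ (IH (ltnW iP))).
by exists (Ordinal (iP : i < n)).
Qed.

Section CylStar.
Context (Sigma : Type) (X : pointed Sigma) (XC : is_CSTS X).

Lemma cyl_CSTS : is_CSTS (cyl X).
Proof.
apply: (pull_CSTS (q := @cyl_proj _ X)) => // [a am|u].
  exists (cyl_in false a); split=> // -[[b e] /= be] ab; rewrite /cyl_proj /= in ab.
  subst b; apply: eq_exist => /=; case: e be => // /(_ isT) []; by right.
by have [a [b T]] := all_actions_used XC u; exists (cyl_in false a), (cyl_in false b).
Qed.

Lemma cyl_star : star_shaped X -> star_shaped (cyl X).
Proof.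
move=> /star_reach XS; apply/star_reach => -[[a e] ae].
have reachF b : reach (cyl_in false b : state (cyl X)).
  exact: (reach_map (cyl_gamma X false)).
case: e ae => ae; last first.
  rewrite (_ : exist _ _ _ = cyl_in false a) //; exact: eq_exist.
(* A state on level 1 is external, hence not the base, so it has a last step from some [b]; in the
   cylinder the same step starts from [b] on level 0. *)
have := ae isT; case: (XS a) ae => [|b u c _ T] ae ac; first by case: ac; left.
exact: (@reach_step _ (cyl X) _ u _ (reachF b)).
Qed.

Lemma cyl_sigma_trans (a : state (cyl X)) us b : trans a us b ->
  trans (cyl_proj a) (map id us) (cyl_proj b).
Proof. by rewrite map_id. Qed.

Definition cyl_sigma : pt_map (cyl X) X :=
  @PtMap _ (cyl X) X (@PsMap Sigma (cyl X) X (@cyl_proj _ X) id (fun=> erefl)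
    cyl_sigma_trans) erefl.

Lemma cyl_sigma_gamma e : pt_comp cyl_sigma (cyl_gamma X e) = pt_id X.
Proof. exact/pt_map_eq/ps_map_eq. Qed.

Lemma cyl_sigma_blowup : blowup cyl_sigma.
Proof.
split=> //= [y|v|a us b]; last by rewrite map_id.
  by exists (cyl_in false y).
by exists v.
Qed.

Lemma cyl_gamma_inj e : injective (on_state (cyl_gamma X e)).
Proof. by move=> a b []. Qed.

End CylStar.

Section Terminal.
Context (Sigma : Type).

(** Each label is its own unique action, so maps into this system are forced by labels. *)
Definition terminal_ps : pointed Sigma :=
  @Defs.Pointed Sigma (@Presystem Sigma unit Sigma id (fun _ us _ => us <> [::])
    (fun _ _ H => H erefl)) tt.

Lemma terminal_CSTS : is_CSTS terminal_ps.
Proof.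
split=> //=.
- move=> _ us vs _ _ P us0 vs0; apply: us0; apply: Permutation_nil.
  by rewrite -vs0; apply: Permutation_sym.
- by move=> _ _ _ _ us [].
- move=> _ _ [|u us] [|v vs] // _ _ _; exists tt; split=> // -[] //.
Qed.

Lemma terminal_star : star_shaped terminal_ps.
Proof. by apply/star_reach => -[]; apply: (@reach_base _ terminal_ps). Qed.

Definition terminal_obj : StarCSTS Sigma :=
  exist _ terminal_ps (conj terminal_CSTS terminal_star).

Lemma to_terminal_trans (X : pointed Sigma) (a : state X) us b :
  trans a us b -> map (@label _ X) us <> [::].
Proof. by case: us => // /trans_nonempty. Qed.

Definition to_terminal (X : pointed Sigma) : pt_map X terminal_ps :=
  @PtMap _ X terminal_ps (@PsMap Sigma X terminal_ps (fun=> tt) (@label _ X)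
    (fun=> erefl) (@to_terminal_trans X)) erefl.

Lemma to_terminal_unique (X : pointed Sigma) (f g : pt_map X terminal_ps) : f = g.
Proof.
apply/pt_map_eq/ps_map_eq; apply: funext => x;
  last exact: (etrans (on_label f x) (esym (on_label g x))).
by case: (on_state f x); case: (on_state g x).
Qed.
End Terminal.

(** * Binary products of star-shaped systems *)

Section Product.
Context (Sigma : Type) (X Y : pointed Sigma) (XC : is_CSTS X) (YC : is_CSTS Y).

Definition pair_action := {uv : action X * action Y | label uv.1 = label uv.2}.

Definition pair_trans (a : state X * state Y) (us : seq pair_action) b :=
  trans a.1 (map (fst \o sval) us) b.1 /\ trans a.2 (map (snd \o sval) us) b.2.

Lemma pair_nonempty a b : ~ pair_trans a [::] b.
Proof. by case=> /trans_nonempty. Qed.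

Definition pair_ps : pointed Sigma :=
  @Defs.Pointed Sigma (@Presystem Sigma (state X * state Y) pair_action
    (fun u => label (sval u).1) pair_trans pair_nonempty) (base X, base Y).

Lemma pair_CSA2 a us vs b : 0 < size us -> 0 < size vs -> pair_trans a (us ++ vs) b ->
  exists! c, pair_trans a us c /\ pair_trans c vs b.
Proof.
rewrite /pair_trans !map_cat => us0 vs0 [T1 T2].
have [||c [[ac cb] cU]] := CSA2_axiom XC _ _ T1; rewrite ?size_map //.
have [||d [[ad db] dU]] := CSA2_axiom YC _ _ T2; rewrite ?size_map //.
by exists (c, d); split=> // -[c' d'] /= [[? ?] [? ?]]; rewrite (cU c') // (dU d').
Qed.

(** CSA2 breaks a transition of any length into 1-transitions. *)
Lemma pair_reach a us b : @reach _ pair_ps a -> pair_trans a us b -> @reach _ pair_ps b.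
Proof.
elim: us a => [|u [|v us] IH] a aR T; first by case: (pair_nonempty T).
  exact: (@reach_step _ pair_ps _ u _ aR).
have [||c [[ac cb] _]] := @pair_CSA2 a [:: u] (v :: us) b _ _ T => //.
by apply: (IH c) => //; apply: (@reach_step _ pair_ps _ u _ aR).
Qed.

(** The componentwise product need be neither star-shaped nor use all its pairs of actions;
    restricting to reachable states and to the actions leaving them repairs both. *)
Definition prod_state := {a : state pair_ps | reach a}.
Definition prod_action :=
  {u : pair_action | exists a b, @reach _ pair_ps a /\ pair_trans a [:: u] b}.

Lemma prod_nonempty (a b : prod_state) :
  ~ pair_trans (sval a) (map sval ([::] : seq prod_action)) (sval b).
Proof. exact: pair_nonempty. Qed.

Definition prod_ps : pointed Sigma :=
  @Defs.Pointed Sigma (@Presystem Sigma prod_state prod_action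
    (fun u => label (sval (sval u)).1)
    (fun a us b => pair_trans (sval a) (map sval us) (sval b)) prod_nonempty)
    (exist _ (base pair_ps) (@reach_base _ pair_ps)).

Lemma prod_CSTS : is_CSTS prod_ps.
Proof.
split=> /=.
- move=> [a aR] us vs [b bR] /= us2 P [T1 T2].
  by split; [apply: (multiset_axiom XC) T1|apply: (multiset_axiom YC) T2];
    rewrite ?size_map //; do 2!apply: Permutation_map.
- move=> [a ?] [b ?] [c ?] [d ?] us vs ws /= us0 vs0 ws0; rewrite !map_cat.
  rewrite /pair_trans !map_cat => -[T1 T2] [ac1 ac2] [cb1 cb2] [ad1 ad2] [db1 db2].
  by split; [apply: (patching_axiom XC _ _ _ T1)|apply: (patching_axiom YC _ _ _ T2)];
    rewrite ?size_map.
- move=> [u [a [b [aR ab]]]]; have bR := pair_reach aR ab.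
  by exists (exist _ a aR), (exist _ b bR).
- move=> [a aR] [b bR] us vs /= us0 vs0; rewrite map_cat => T.
  have [||c [[ac cb] cU]] := pair_CSA2 _ _ T; rewrite ?size_map //.
  exists (exist _ c (pair_reach aR ac)); split=> // -[c' ?] /= /cU ?.
  exact: eq_exist.
- move=> a b [[[u u'] uu'] uR] [[[v v'] vv'] vR] /= [T1 T2] [T1' T2'] uv.
  apply: eq_exist => /=; apply: eq_exist => /=; congr pair.
    exact: (CSA1_axiom XC T1 T1').
  exact: (CSA1_axiom YC T2 T2' (etrans (esym uu') (etrans uv vv'))).
Qed.

Lemma prod_star : star_shaped prod_ps.
Proof.
apply/star_reach => -[a aR].
(* The proof of reachability stored in the state is generalized, so that the induction does not
   depend on it. *)
suff H : forall aR', @reach _ prod_ps (exist _ a aR') by [].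
elim: aR => [|{}a u b aR IH T] aR'.
  have -> : exist _ _ aR' = base prod_ps by apply: eq_exist.
  exact: reach_base.
have uP : exists a b, @reach _ pair_ps a /\ pair_trans a [:: u] b by exists a, b.
exact: (@reach_step _ prod_ps _ (exist _ u uP) _ (IH aR)).
Qed.

Lemma prod_fst_trans (a : state prod_ps) us b : trans a us b ->
  trans (sval a).1 (map (fun u : prod_action => (sval (sval u)).1) us) (sval b).1.
Proof. by move=> [] /=; rewrite -map_comp. Qed.

Lemma prod_snd_trans (a : state prod_ps) us b : trans a us b ->
  trans (sval a).2 (map (fun u : prod_action => (sval (sval u)).2) us) (sval b).2.
Proof. by move=> [_] /=; rewrite -map_comp. Qed.

Definition prod_fst : pt_map prod_ps X :=
  @PtMap _ prod_ps X (@PsMap Sigma prod_ps X (fun a => (sval a).1)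
    (fun u => (sval (sval u)).1) (fun=> erefl) prod_fst_trans) erefl.

Definition prod_snd : pt_map prod_ps Y :=
  @PtMap _ prod_ps Y (@PsMap Sigma prod_ps Y (fun a => (sval a).2)
    (fun u => (sval (sval u)).2) (fun u => esym (svalP (sval u))) prod_snd_trans) erefl.

Lemma prod_map_eq (Z : pointed Sigma) (f g : pt_map Z prod_ps) :
  pt_comp prod_fst f = pt_comp prod_fst g -> pt_comp prod_snd f = pt_comp prod_snd g ->
  f = g.
Proof.
move=> /(congr1 (@pt_ps_map _ _ _))/ps_map_congr[fg1 fg1'].
move=> /(congr1 (@pt_ps_map _ _ _))/ps_map_congr[fg2 fg2'].
apply/pt_map_eq/ps_map_eq; apply: funext => x.
  apply/eq_sig_hprop; first by move=> *; apply: Prop_irrelevance.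
  by rewrite [LHS]surjective_pairing [RHS]surjective_pairing; congr pair; [apply: fg1|apply: fg2].
do 2!(apply/eq_sig_hprop; first by move=> *; apply: Prop_irrelevance).
by rewrite [LHS]surjective_pairing [RHS]surjective_pairing; congr pair;
  [apply: fg1'|apply: fg2'].
Qed.

Section Pairing.
Context (Z : pointed Sigma) (ZC : is_CSTS Z) (ZS : star_shaped Z).
Context (f : pt_map Z X) (g : pt_map Z Y).

Definition pairing_action (u : action Z) : pair_action :=
  exist _ (on_action f u, on_action g u) (etrans (on_label f u) (esym (on_label g u))).

Lemma pairing_trans0 (a : state Z) us b : trans a us b ->
  @trans _ pair_ps (on_state f a, on_state g a) (map pairing_action us)
    (on_state f b, on_state g b).
Proof.
by move=> T; split; rewrite -map_comp /=; apply: on_trans.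
Qed.

Lemma pairing_base : (on_state f (base Z), on_state g (base Z)) = base pair_ps.
Proof. by rewrite !pt_base. Qed.

Definition pairing0 : pt_map Z pair_ps :=
  @PtMap _ Z pair_ps (@PsMap Sigma Z pair_ps (fun a => (on_state f a, on_state g a))
    pairing_action (on_label f) pairing_trans0) pairing_base.

Lemma pairing_reach a : @reach _ pair_ps (on_state f a, on_state g a).
Proof. by move/star_reach: ZS => ZR; apply: (reach_map pairing0 (ZR a)). Qed.

Lemma pairing_used u : exists a b,
  @reach _ pair_ps a /\ pair_trans a [:: pairing_action u] b.
Proof.
have [a [b T]] := all_actions_used ZC u.
exists (on_state f a, on_state g a), (on_state f b, on_state g b).
split; [exact: pairing_reach|exact: (pairing_trans0 T)].
Qed.

Lemma pairing_trans (a : state Z) us b : trans a us b ->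
  @trans _ prod_ps (exist _ _ (pairing_reach a))
    (map (fun u => exist _ _ (pairing_used u)) us) (exist _ _ (pairing_reach b)).
Proof. by move=> /pairing_trans0 T; rewrite /= -map_comp. Qed.

Lemma pairing_base' : exist _ _ (pairing_reach (base Z)) = base prod_ps.
Proof. exact/eq_exist/pairing_base. Qed.

Definition pairing : pt_map Z prod_ps :=
  @PtMap _ Z prod_ps (@PsMap Sigma Z prod_ps (fun a => exist _ _ (pairing_reach a))
    (fun u => exist _ _ (pairing_used u)) (on_label f) pairing_trans) pairing_base'.

Lemma pairing_fst : pt_comp prod_fst pairing = f.
Proof. exact/pt_map_eq/ps_map_eq. Qed.

Lemma pairing_snd : pt_comp prod_snd pairing = g.
Proof. exact/pt_map_eq/ps_map_eq. Qed.
End Pairing.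

End Product.

(** * Past-similarity *)

Lemma homotopy_past_similar (Sigma : Type) (X : pointed Sigma) n (w : n.-tuple Sigma)
    (H : pt_map (cyl (path_ps w)) X) :
  past_similar (on_state H (cyl_in false (ord_max : state (path_ps w))))
    (on_state H (cyl_in true (ord_max : state (path_ps w)))).
Proof.
exists n, w, (pt_comp H (cyl_gamma _ false)), (pt_comp H (cyl_gamma _ true)).
by split=> //; exists H.
Qed.

Lemma past_similar_map (Sigma : Type) (X Y : pointed Sigma) (f : pt_map X Y) a b :
  past_similar a b -> past_similar (on_state f a) (on_state f b).
Proof.
case=> n [w [g [h [[H [Hg Hh]] <- <-]]]].
exists n, w, (pt_comp f g), (pt_comp f h); split=> //; exists (pt_comp f H).
by rewrite -Hg -Hh; split; apply/pt_map_eq/ps_map_eq.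
Qed.

Lemma past_similar_refl (Sigma : Type) (X : pointed Sigma) : star_shaped X ->
  forall a : state X, past_similar a a.
Proof.
move=> XS a; have [n [w [f <-]]] := XS a; exists n, w, f, f; split=> //.
by exists (pt_comp f (cyl_sigma _)); split; apply/pt_map_eq/ps_map_eq.
Qed.

(** A path has no transition of length two, so only its base is internal; length [n.+1] keeps the
    end distinct from the base, and the cylinder doubles it. *)
Lemma path_end_external (Sigma : Type) n (w : n.+1.-tuple Sigma) :
  external (ord_max : state (path_ps w)).
Proof.
case=> [/(congr1 val) //|[c [d [us [vs [[k [_ + _]] cu ud]]]]]].
by case: us cu => [/path_nonempty//|i [|//]]; case: vs ud => [/path_nonempty|].
Qed.

(** * Interchangeable states *)

Section Interchange.
Context (Sigma : Type) (X : pointed Sigma).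
Implicit Types a b c d : state X.

Definition interchangeable a b := forall us c,
  (trans a us c <-> trans b us c) /\ (trans c us a <-> trans c us b).

Lemma interchangeable_refl a : interchangeable a a.
Proof. by []. Qed.

Lemma interchangeable_sym a b : interchangeable a b -> interchangeable b a.
Proof. by move=> ab us c; have [[] ? ? [] ? ?] := ab us c. Qed.

Lemma interchangeable_trans a b c :
  interchangeable a b -> interchangeable b c -> interchangeable a c.
Proof.
move=> ab bc us d; have [] := ab us d; have [] := bc us d.
by move=> -> -> -> ->.
Qed.

Lemma trans_interchangeable a a' us b b' : interchangeable a a' ->
  interchangeable b b' -> trans a us b -> trans a' us b'.
Proof. by move=> aa' bb' /(aa' us b).1; apply: (bb' us a').2.1. Qed.

Section Blur.
Context (n : nat) (s : nat -> state X) (u : 'I_n.+1 -> action X) (c d : state X).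
Context (s0 : s 0 = base X)
  (su : forall k : 'I_n.+1, trans (s k) [:: u k] (s k.+1))
  (sc : interchangeable (s n.+1) c) (sd : interchangeable (s n.+1) d).
Let P := path_ps (path_word u).

(** The constant homotopy on a path, except that the two copies of its end go to [c] and [d]. *)
Definition blur_state (p : cyl_state P) :=
  if (sval p).1 == ord_max :> 'I_n.+2 then if (sval p).2 then d else c
  else s (sval p).1.

Lemma blur_trans (p : state (cyl P)) us q : trans p us q ->
  trans (blur_state p) (map u us) (blur_state q).
Proof.
case: p q => -[i e] ie [[j e'] je'] /= [k [ik -> jk]].
rewrite /cyl_proj /= in ik jk; rewrite /blur_state /=.
(* No step starts at the end of the path, so only its target can have been moved. *)
have -> : (i == ord_max) = false.
  by apply/eqP => iM; move: ik (ltn_ord k); rewrite iM /= => <-; rewrite ltnn.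
case: eqP => [jM|_]; last by rewrite ik jk.
have := su k; rewrite -jk -ik jM /=.
by case: e' {je'} => /(trans_interchangeable (interchangeable_refl _)); apply.
Qed.

Definition blur : pt_map (cyl P) X :=
  @PtMap _ (cyl P) X (@PsMap Sigma (cyl P) X blur_state u (path_on_label u) blur_trans) s0.

Lemma blur_past_similar : past_similar c d.
Proof.
have := homotopy_past_similar blur; rewrite /= /blur_state /= eqxx.
by case: asboolP => // /(_ (@path_end_external _ _ _)).
Qed.
End Blur.

(** If [a] or [b] is the end of a nonempty path, blurring that end gives the homotopy; otherwise
    both are the base. *)
Lemma interchangeable_past_similar a b :
  star_shaped X -> interchangeable a b -> past_similar a b.
Proof.
move=> XS ab; have /star_reach XR := XS.
have [[|n] [s [u [s0 su sn]]]] := reach_path (XR a); last first.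
  by apply: (blur_past_similar s0 su); rewrite sn.
have [[|m] [t [v [t0 tv tm]]]] := reach_path (XR b); last first.
  by apply: (blur_past_similar t0 tv); rewrite tm //; apply: interchangeable_sym.
by rewrite -sn -tm s0 t0; apply: past_similar_refl.
Qed.

End Interchange.

Lemma interchangeable_eq (Sigma : Type) (X Y : pointed Sigma) (f : pt_map X Y)
    (a b : state X) : star_shaped X -> reduced Y -> interchangeable a b ->
  on_state f a = on_state f b.
Proof.
move=> XS YR /(interchangeable_past_similar XS)/(past_similar_map f).
by move/YR.
Qed.

Lemma blowup_interchangeable (Sigma : Type) (X Y : pointed Sigma) (p : pt_map X Y)
    (a b : state X) :
  blowup p -> on_state p a = on_state p b -> interchangeable a b.
Proof.
move=> pB pab us c; split; split=> /(on_trans p) T; apply: (blowup_trans pB);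
  by rewrite ?pab // -pab.
Qed.

(** The choice is made from the class as a predicate, and equivalent points have equal predicates by
    extensionality; [x0] is the default for the empty predicate. *)
Lemma choose_representatives (T : Type) (x0 : T) (r : T -> T -> Prop) :
  (forall x, r x x) -> (forall x y, r x y -> r y x) ->
  (forall x y z, r x y -> r y z -> r x z) ->
  exists rep : T -> T, (forall x, r x (rep x)) /\ (forall x y, r x y -> rep x = rep y).
Proof.
move=> r_refl r_sym r_trans.
have /choice[F FP] : forall P : T -> Prop, exists y, (exists x, P x) -> P y.
  move=> P; have [[x Px]|nP] := pselect (exists x, P x); first by exists x.
  by exists x0.
exists (fun x => F (r x)); split=> [x|x y xy]; first by apply: FP; exists x.
congr F; apply: funext => z; apply: propext.
by split; apply: r_trans => //; apply: r_sym.
Qed.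

(** * The quotient by interchangeability *)

Section Quotient.
Context (Sigma : Type) (X : pointed Sigma) (XC : is_CSTS X) (XS : star_shaped X).
Context (rep : state X -> state X).
Context (repP : forall a, interchangeable a (rep a))
  (rep_eq : forall a b, interchangeable a b -> rep a = rep b).

Lemma rep_idem a : rep (rep a) = rep a.
Proof. by rewrite -(rep_eq (repP a)). Qed.

Lemma middle_interchangeable (a b : state X) : middle a -> interchangeable a b -> a = b.
Proof.
move=> [c [d [us [vs [T ca ad]]]]] ab; apply: (middle_unique XC T) => //.
  exact: (ab us c).2.1.
exact: (ab vs d).1.1.
Qed.

(** The quotient is realized on the chosen representatives, so its transitions are restricted from
    [X]. *)
Definition quot_state := {a : state X | rep a = a}.

Definition to_quot (a : state X) : quot_state := exist _ (rep a) (rep_idem a).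

Definition quot : pointed Sigma :=
  @Defs.Pointed Sigma (pull (sval : quot_state -> state X)) (to_quot (base X)).

Lemma quot_trans (a : state X) us b : trans a us b ->
  @trans _ quot (to_quot a) (map id us) (to_quot b).
Proof. by rewrite map_id; apply: trans_interchangeable. Qed.

Definition quot_map : pt_map X quot :=
  @PtMap _ X quot (@PsMap Sigma X quot (fun a => to_quot a) id
    (fun=> erefl) quot_trans) erefl.

Lemma quot_CSTS : is_CSTS quot.
Proof.
apply: pull_CSTS => // [a am|u].
  have ra : rep a = a by apply/esym/middle_interchangeable.
  exists (exist (fun a => rep a = a) a ra); split=> // -[b rb] /= ab; exact: eq_exist.
have [a [b /quot_trans]] := all_actions_used XC u.
by exists (to_quot a), (to_quot b).
Qed.

Lemma quot_blowup : blowup quot_map.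
Proof.
split=> [[a ra]|//|u|a us b /=].
- by exists a; apply: eq_exist.
- by exists u.
by rewrite map_id; apply: trans_interchangeable; apply: interchangeable_sym.
Qed.

Lemma quot_star : star_shaped quot.
Proof. exact: (star_image (blowup_state quot_blowup)). Qed.

(* Homotopies of paths lift along [quot_map]. *)
Lemma quot_reduced :
  (forall a b : state X, past_similar a b -> interchangeable a b) -> reduced quot.
Proof.
move=> ps a b; split=> [|->]; last exact: past_similar_refl quot_star _.
case=> n [w [f [g [[H [<- <-]] <- <-]]]].
(* The representative of the base may differ from the base, so the lifted homotopy is corrected
   there; it stays interchangeable with the original. *)
have /choice[h hP] (p : state (cyl (path_ps w))) : exists c,
    interchangeable c (sval (on_state H p)) /\ (p = base _ -> c = base X).
  have [->|] := pselect (p = base _); last by exists (sval (on_state H p)).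
  by exists (base X); split=> //; rewrite pt_base; apply: repP.
have ht p us q : trans p us q -> trans (h p) (map (on_action H) us) (h q).
  move=> /(on_trans H); apply: (@trans_interchangeable _ X (sval (on_state H p)) _ _
    (sval (on_state H q))); exact: (hP _).1 || exact/interchangeable_sym/(hP _).1.
pose h' : pt_map (cyl (path_ps w)) X := @PtMap _ (cyl (path_ps w)) X
  (@PsMap _ (cyl (path_ps w)) X h (on_action H) (on_label H) ht) ((hP _).2 erefl).
have := ps _ _ (homotopy_past_similar h'); rewrite /path_end /=.
set p := cyl_in _ _; set q := cyl_in _ _ => pq.
apply: eq_sig_hprop => [? ? ?|]; first exact: Prop_irrelevance.
rewrite -[LHS](svalP (on_state H p)) -[RHS](svalP (on_state H q)).
apply: rep_eq; apply: interchangeable_trans (hP q).1.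
apply: interchangeable_trans pq; apply: interchangeable_sym; exact: (hP p).1.
Qed.

End Quotient.

(** * Maps inverted by a reflective subcategory *)

Section Local.
Context (C : category) (P : C -> Prop).

(** Orthogonality to every object satisfying [P]. When a reflection onto [P] exists, these are the
    maps that it sends to isomorphisms. *)
Definition inverted : morph_class C := fun X Y f =>
  forall Z : C, P Z -> forall g : hom X Z, exists! h : hom Y Z, h ∘ f = g.

Lemma inverted_epi (X Y Z : C) (f : hom X Y) (g h : hom Y Z) :
  inverted f -> P Z -> g ∘ f = h ∘ f -> g = h.
Proof.
move=> fI PZ gh; have [k [_ kU]] := fI Z PZ (h ∘ f).
by rewrite -(kU g gh) -(kU h erefl).
Qed.

Lemma inverted_iso (X Y : C) (f : hom X Y) : P X -> P Y -> inverted f -> is_iso f.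
Proof.
move=> PX PY fI; have [g [gf _]] := fI X PX (idm X).
by exists g; split=> //; apply: (inverted_epi fI) => //; rewrite -Defs.compA gf compm1 comp1m.
Qed.

Lemma inverted_two_of_three : two_of_three inverted.
Proof.
move=> X Y Z f g; split.
- move=> fI gI T PT k; have [l [lf _]] := fI T PT k; have [m [mg _]] := gI T PT l.
  exists m; split=> [|m' m'gf]; first by rewrite Defs.compA mg.
  apply: (inverted_epi gI) => //; apply: (inverted_epi fI) => //.
  by rewrite -!Defs.compA m'gf Defs.compA mg.
- move=> fI gfI T PT k; have [l [lgf _]] := gfI T PT (k ∘ f).
  have lg : l ∘ g = k by apply: (inverted_epi fI) => //; rewrite -Defs.compA.
  exists l; split=> // l' l'g; apply: (inverted_epi gfI) => //.
  by rewrite lgf Defs.compA l'g.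
- move=> gI gfI T PT k; have [l [lgf _]] := gfI T PT k.
  exists (l ∘ g); split=> [|m mf]; first by rewrite -Defs.compA.
  have [n [ng _]] := gI T PT m; rewrite -ng; congr (_ ∘ g).
  by apply: (inverted_epi gfI) => //; rewrite lgf Defs.compA ng.
Qed.

Lemma inverted_retract : retract_closed inverted.
Proof.
move=> X Y X' Y' f g [i [r [j [s [ri sj gi fr]]]]] gI Z PZ k.
have [l [lg _]] := gI Z PZ (k ∘ r).
exists (l ∘ j); split=> [|m mf].
  by rewrite -Defs.compA -gi Defs.compA lg -Defs.compA ri compm1.
rewrite -[m]compm1 -sj Defs.compA; congr (_ ∘ j); apply: (inverted_epi gI) => //.
by rewrite lg -Defs.compA -fr Defs.compA mf.
Qed.

Lemma inverted_pushout : pushout_closed inverted.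
Proof.
move=> A B X Y f g f' g' po fI Z PZ x; have [b [bf _]] := fI Z PZ (x ∘ g).
have [h [[hf' hg'] hU]] := po.2 Z x b (esym bf).
exists h; split=> // k kf'; apply: hU; split=> //; apply: (inverted_epi fI) => //.
by rewrite -Defs.compA -po.1 Defs.compA kf'.
Qed.

Lemma wo_cases (I : well_order) (j : I) :
  [\/ wbot I = j, exists i : I, wsucc i j | wlimit j].
Proof.
have [->|bj] := wbot_least j; first by constructor 1.
have [jl|nl] := pselect (wlimit j); first by constructor 3.
constructor 2; apply: contrapT => ns; apply: nl; split=> // i ij.
apply: contrapT => nk; apply: ns; exists i; split=> // k ik.
by have [kj|[->|jk]] := wlt_total k j; [case: nk; exists k|left|right].
Qed.

(** * Transfinite compositions of inverted maps *)

Section Chain.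
Context (I : well_order) (F : chain C I) (Z : C) (PZ : P Z) (g : hom (F (wbot I)) Z).

Let extends (i : I) (d : hom (F i) Z) := d ∘ chain_map F (wbot_least i) = g.

Lemma chain_map_irr (i j : I) (l l' : wle i j) : chain_map F l = chain_map F l'.
Proof. by congr chain_map; apply: Prop_irrelevance. Qed.

Lemma extends_restrict (i j : I) (l : wle i j) d : extends d -> @extends i (d ∘ chain_map F l).
Proof. by rewrite /extends -Defs.compA (chain_comp F _ _ (wbot_least j)). Qed.

(** Restrictions of extensions of [g] are extensions, so uniqueness at each stage makes them a
    cocone. The predicate [Q] covers both limit stages and the whole chain. *)
Lemma colimit_extends (Q : I -> Prop) (qb : Q (wbot I)) (Y : C)
    (c : forall i : I, Q i -> hom (F i) Y) :
  is_chain_colimit (F := F) c -> (forall i, Q i -> exists! d, @extends i d) ->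
  exists! d : hom Y Z, d ∘ c (wbot I) qb = g.
Proof.
move=> [cc cU] QE.
pose d i (qi : Q i) := sval (cid (QE i qi)).
have dE i (qi : Q i) : extends (d i qi) by rewrite /d; case: cid => ? [].
have dU i (qi : Q i) e : extends e -> d i qi = e by rewrite /d; case: cid => /= ? [_]; apply.
have [|h [hc hU]] := cU Z d.
  by move=> i j l qi qj; apply/esym/dU/extends_restrict/dE.
have cE k i (qi : Q i) : k ∘ c (wbot I) qb = g -> @extends i (k ∘ c i qi).
  by move=> kg; rewrite /extends -Defs.compA (cc _ _ _ qb).
exists h; split=> [|k kg].
  by rewrite hc; have := dE _ qb; rewrite /extends chain_id compm1.
by apply: hU => i qi; apply/esym/dU/cE.
Qed.

Lemma chain_extends : smooth_chain F ->
  (forall (i j : I) (l : wle i j), wsucc i j -> inverted (chain_map F l)) ->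
  forall i, exists! d, @extends i d.
Proof.
move=> Fsm Fs; apply: (well_founded_ind (@wlt_wf I)) => j IH.
have [bj|[i ij]|jl] := wo_cases j.
- subst j; exists g; split=> [|d]; first by rewrite /extends chain_id compm1.
  by rewrite /extends chain_id compm1.
- have [d [dE dU]] := IH i ij.1; pose l : wle i j := or_intror ij.1.
  have [e [ed eU]] := Fs i j l ij Z PZ d.
  exists e; split=> [|e' e'E].
    by rewrite /extends -(chain_comp F (wbot_least i) l) Defs.compA ed.
  by apply: eU; apply/esym/dU/extends_restrict.
have [e [eg eU]] := colimit_extends jl.1 (Fsm j jl) IH.
exists e; split=> [|e' e'E]; first by rewrite /extends (chain_map_irr _ (or_intror jl.1)).
by apply: eU; rewrite -e'E (chain_map_irr _ (wbot_least j)).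
Qed.
End Chain.

Lemma inverted_transfinite : transfinite_closed inverted.
Proof.
move=> I F Fsm Fs Z c cc T PT g; apply: (colimit_extends Logic.I cc) => i _.
exact: chain_extends.
Qed.

(** Intersecting with [W] is what keeps the pushouts and compositions in [K]: for a general [K] this
    stability is known only for maps in both [K] and [W]. *)
Lemma localizer_inverted (K W : morph_class C) :
  is_localizer K W ->
  (forall (X Y : C) (p : hom X Y), rlp K p -> inverted p) ->
  is_localizer K (capm W inverted).
Proof.
move=> [Wr Wt Wret Wpo Wtr] rI; split.
- by move=> X Y p pR; split; [apply: Wr|apply: rI].
- move=> X Y Z f g; have [w1 w2 w3] := Wt X Y Z f g.
  have [i1 i2 i3] := inverted_two_of_three f g.
  split=> -[? ?] [? ?]; split; do ?[exact: w1|exact: w2|exact: w3|exact: i1|exact: i2|exact: i3].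
- move=> X Y X' Y' f g fg [gW gI]; split; first exact: Wret fg gW.
  exact: inverted_retract fg gI.
- move=> A B X Y f g f' g' po [fK [fW fI]].
  have [] := Wpo _ _ _ _ _ _ _ _ po (conj fK fW).
  by split=> //; split=> //; apply: inverted_pushout po fI.
move=> I F Fsm Fs Z c cc.
have [|cK cW] := Wtr I F Fsm _ Z c cc; first by move=> i j l /Fs[? []].
by split=> //; split=> //; apply: inverted_transfinite cc => // i j l /Fs[? []].
Qed.

Lemma left_determined_inverted (M : model_structure C) : left_determined M ->
  (forall (X Y : C) (p : hom X Y), rlp (cof M) p -> inverted p) ->
  forall (X Y : C) (f : hom X Y), weq M f -> inverted f.
Proof.
by move=> [ML Mmin] rI X Y f /(Mmin _ (localizer_inverted ML rI))[].
Qed.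

End Local.

(** * Construction of the reflection *)

Section Reflection.
Context (C : category) (P : C -> Prop).
Context (refl : forall X : C, exists (Z : C) (e : hom X Z), P Z /\ inverted P e).

(** An inverted map into an object of [P] is a universal arrow, and a choice of universal arrows is
    a left adjoint. *)
Lemma reflection_adjunction : exists R : functor C (full_sub P),
  inhabited (adjunction R (inclusion P)).
Proof.
have /choice[R0 R0P] : forall X : C, exists Z : full_sub P,
    exists e : hom X (sval Z), inverted P e.
  by move=> X; have [Z [e [PZ eI]]] := refl X; exists (exist _ Z PZ), e.
pose e X := sval (cid (R0P X)).
have eI X : inverted P (e X) by apply: (svalP (cid (R0P X))).
pose ext X (Z : full_sub P) (g : hom X (sval Z)) : hom (sval (R0 X)) (sval Z) :=
  sval (cid (eI X _ (svalP Z) g)).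
have extE X Z g : ext X Z g ∘ e X = g by rewrite /ext; case: cid => h [].
have extU X (Z : full_sub P) (h h' : hom (sval (R0 X)) (sval Z)) :
    h ∘ e X = h' ∘ e X -> h = h'.
  exact: (inverted_epi (eI X) (svalP Z)).
pose R1 X Y (f : hom X Y) : hom (R0 X) (R0 Y) := ext X (R0 Y) (e Y ∘ f).
have R1E X Y (f : hom X Y) : (R1 X Y f : hom (sval (R0 X)) (sval (R0 Y))) ∘ e X = e Y ∘ f.
  exact: extE.
have R1id X : R1 X X (idm X) = idm (R0 X).
  by apply: extU; rewrite R1E compm1 [RHS]comp1m.
have R1comp X Y Z (g : hom Y Z) (f : hom X Y) : R1 X Z (g ∘ f) = R1 Y Z g ∘ R1 X Y f.
  apply: extU; rewrite R1E /= -[RHS]Defs.compA (R1E _ _ f) [RHS]Defs.compA (R1E _ _ g).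
  exact: Defs.compA.
pose R := Functor R1id R1comp.
pose eps (Y : full_sub P) : hom (R (inclusion P Y)) Y := ext (sval Y) Y (idm (sval Y)).
have epsE (Y : full_sub P) :
    (eps Y : hom (sval (R0 (sval Y))) (sval Y)) ∘ e (sval Y) = idm (sval Y).
  exact: extE.
exists R; constructor; apply: (@Adjunction _ _ R (inclusion P) e eps).
- by move=> X X' f; rewrite /= R1E.
- move=> Y Y' g; apply: extU.
  rewrite /= -[LHS]Defs.compA R1E [LHS]Defs.compA epsE comp1m -[RHS]Defs.compA epsE.
  by rewrite compm1.
- move=> X; apply: extU.
  by rewrite /= -[LHS]Defs.compA R1E [LHS]Defs.compA epsE [RHS]comp1m comp1m.
- by move=> Y; apply: epsE.
Qed.

End Reflection.

(** * From a reflection to a Quillen equivalence *)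

Section QuillenEquivalence.
Context (C : category) (M : model_structure C) (P : C -> Prop).

Lemma unit_inverted (R : functor C (full_sub P)) (adj : adjunction R (inclusion P)) X :
  inverted P (adj_unit adj X).
Proof.
move=> Z PZ g; pose Z' : full_sub P := exist _ Z PZ.
exists ((adj_counit adj Z' ∘ fmap R (g : hom X (inclusion P Z'))) : hom (R X) Z').
split=> [|h hg].
  rewrite /= -Defs.compA -(adj_unit_nat adj g) Defs.compA.
  by rewrite -[RHS]comp1m; congr (_ ∘ g); apply: (adj_triangleR adj Z').
pose h' : hom (R X) Z' := h.
have hE : adj_counit adj Z' ∘ fmap R (fmap (inclusion P) h' ∘ adj_unit adj X) = h'.
  by rewrite fmap_comp Defs.compA adj_counit_nat -Defs.compA adj_triangleL compm1.
by rewrite -hg; apply: hE.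
Qed.

(** Isomorphisms lift against every map, in particular against fibrations, so they are trivial
    cofibrations. *)
Lemma iso_weq (X Y : C) (f : hom X Y) : is_iso f -> weq M f.
Proof.
move=> fI; have [L _ _] := trivcof_fib_wfs M.
suff : capm (cof M) (weq M) f by case.
by apply/L => A B p _; apply: iso_lifts; left.
Qed.

Context (weqI : forall (X Y : C) (f : hom X Y), weq M f -> inverted P f).
Context (repl : forall X : C, exists (Z : C) (e : hom X Z), P Z /\ weq M e).

(** The replacement [e] of [X] factors through [f] by a map [h] between objects of [P]. This [h] is
    inverted, hence an isomorphism, and two-out-of-three applies. *)
Lemma inverted_weq_to (X Z : C) (f : hom X Z) : P Z -> inverted P f -> weq M f.
Proof.
move=> PZ fI; have [T [e [PT eW]]] := repl X.
have [h [hf _]] := fI T PT e.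
have hI : inverted P h.
  by have [_ H _] := inverted_two_of_three P f h; apply: H => //; rewrite hf; apply: weqI.
have [_ _ H] := weq_two_of_three M f h; apply: H; last by rewrite hf.
exact/iso_weq/(inverted_iso _ _ hI).
Qed.

(** The unit is a weak equivalence, and weak equivalences between objects of [P] are exactly the
    isomorphisms. Two-out-of-three in the naturality square of the unit gives the rest. *)
Theorem reflection_quillen_equivalence (R : functor C (full_sub P))
    (adj : adjunction R (inclusion P)) :
  quillen_equivalence M (discrete_model (full_sub P)) adj /\
  forall (X Y : C) (f : hom X Y), weq M f <-> is_iso (fmap R f).
Proof.
have unitW X : weq M (adj_unit adj X).
  by apply: inverted_weq_to; [apply: (svalP (R X))|apply: unit_inverted].
have sub_iso (X Y : full_sub P) (f : hom X Y) :
    weq M (f : hom (sval X) (sval Y)) <-> is_iso f.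
  split=> [fW|[g [gf fg]]]; last by apply: iso_weq; exists g.
  by have [g [gf fg]] := inverted_iso (svalP X) (svalP Y) (weqI fW); exists g.
have weqE X Y (f : hom X Y) : weq M f <-> is_iso (fmap R f).
  rewrite -sub_iso; have := adj_unit_nat adj f; rewrite /= => fn.
  have [c12 c13 _] := weq_two_of_three M (adj_unit adj X)
    (fmap R f : hom (sval (R X)) (sval (R Y))).
  have [d12 _ d23] := weq_two_of_three M f (adj_unit adj Y).
  split=> fW; first by apply: c13 => //; rewrite -fn; apply: d12.
  by apply: d23 => //; rewrite fn; apply: c12.
split=> //; split; first by split=> // X Y f _ /weqE.
move=> X Y _ _ f; rewrite [weq _ _]/= -sub_iso.
have [c12 c13 _] := weq_two_of_three M (adj_unit adj X)
  (f : hom (sval (R X)) (sval Y)).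
by split=> fW; [apply: c12|apply: c13].
Qed.

End QuillenEquivalence.

(** * The model category of star-shaped transition systems *)

Section StarTrivialFibrations.
Context (Sigma : Type).
Implicit Types X Y A B : StarCSTS Sigma.

Definition star_obj (X : pointed Sigma) (XC : is_CSTS X) (XS : star_shaped X) :
  StarCSTS Sigma := exist _ X (conj XC XS).

Lemma star_cofI A B (i : hom A B) :
  (forall x y, on_state (i : pt_map _ _) x = on_state (i : pt_map _ _) y ->
     x = y \/ middle (on_state (i : pt_map _ _) x)) -> StarCSTS_cof i.
Proof. by move=> iP; apply: CSTS_cofI. Qed.

Lemma blowup_star_rlp X Y (p : hom X Y) :
  blowup (p : pt_map _ _) -> rlp (@StarCSTS_cof Sigma) p.
Proof.
move=> pB A B i iC a b pabi.
have [|h [hi ph]] := iC _ _ (underlying_map p) (blowup_rlp pB)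
    (underlying_map a) (underlying_map b).
  exact: (congr1 (@pt_ps_map _ _ _) pabi).
(* The unpointed lift preserves the base because [i] and [a] do and the upper triangle commutes. *)
have hb : on_state (h : ps_map _ _) (base (sval B)) = base (sval X).
  rewrite -(pt_base (i : pt_map _ _)) -(pt_base (a : pt_map _ _)).
  by have [his _] := ps_map_congr hi; apply: his.
by exists (PtMap hb : pt_map (sval B) (sval X)); split; apply/pt_map_eq.
Qed.

Section Blowdown.
Context (X Y : StarCSTS Sigma) (p : hom X Y).
Context (pR : rlp (@StarCSTS_cof Sigma) p).

Let nil_word : 0.-tuple Sigma := [tuple of [::]].

Definition point_obj : StarCSTS Sigma :=
  star_obj (path_CSTS nil_word) (@path_star _ _ nil_word).

(** The inclusion of the base is injective on states, hence a cofibration; lifting the identity of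
    [Y] against it gives the section. *)
Lemma star_rlp_section : exists s : hom Y X, p ∘ s = idm Y.
Proof.
have no k : k < 0 -> False by [].
pose pt (Z : StarCSTS Sigma) : hom point_obj Z := @PtMap _ (path_ps nil_word) (sval Z)
  (@PsMap _ (path_ps nil_word) (sval Z) (fun=> base (sval Z))
    (fun k => match no _ (ltn_ord k) with end)
    (fun k => match no _ (ltn_ord k) with end)
    (fun _ _ _ '(ex_intro k _) => match no _ (ltn_ord k) with end)) erefl.
have [||s [_ ps]] := pR (i := pt Y) _ (a := pt X) (b := idm Y).
- by apply: star_cofI => x y _; left; rewrite [x]ord1 [y]ord1.
- apply/pt_map_eq/ps_map_eq; apply: funext => k; last by case: (no _ (ltn_ord k)).
  exact: (pt_base (p : pt_map _ _)).
by exists s.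
Qed.

Context (s : hom Y X) (ps : p ∘ s = idm Y).
Let pf : pt_map (sval X) (sval Y) := p.
Let sf : pt_map (sval Y) (sval X) := s.

Lemma section_state y : on_state pf (on_state sf y) = y.
Proof. by have [+ _] := ps_map_congr (congr1 (@pt_ps_map _ _ _) ps); apply. Qed.

Lemma section_action v : on_action pf (on_action sf v) = v.
Proof. by have [_ +] := ps_map_congr (congr1 (@pt_ps_map _ _ _) ps); apply. Qed.

(* Collapses the fibres of [p] over the middle states, which is forced when the
   transitions of [Y] are pulled back. *)
Definition collapse (x : state (sval X)) :=
  if `[< middle (on_state pf x) >] then on_state sf (on_state pf x) else x.

Lemma collapse_over x : on_state pf (collapse x) = on_state pf x.
Proof. by rewrite /collapse; case: asboolP => // _; rewrite section_state. Qed.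

Lemma collapse_section y : collapse (on_state sf y) = on_state sf y.
Proof. by rewrite /collapse section_state; case: asboolP. Qed.

Lemma collapse_idem x : collapse (collapse x) = collapse x.
Proof.
rewrite {1 3}/collapse collapse_over; case: asboolP => // nm.
by rewrite /collapse; case: asboolP.
Qed.

Definition collapsed := {x : state (sval X) | collapse x = x}.

Definition to_collapsed x : collapsed := exist _ (collapse x) (collapse_idem x).

(** The middle object of a factorization of [p]: the states of [X] after the collapse, with the
    actions and transitions of [Y]. The map from [X] is a cofibration, and the map to [Y] reflects
    transitions. *)
Definition blowdown : pointed Sigma :=
  @Defs.Pointed Sigma (pull (fun x : collapsed => on_state pf (sval x)))
    (to_collapsed (base (sval X))).

Lemma to_blowdown_trans (a : state (sval X)) us b : trans a us b ->
  @trans _ blowdown (to_collapsed a) (map (on_action pf) us) (to_collapsed b).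
Proof. by rewrite /= !collapse_over; apply: on_trans. Qed.

Definition to_blowdown : pt_map (sval X) blowdown :=
  @PtMap _ (sval X) blowdown (@PsMap Sigma (sval X) blowdown to_collapsed (on_action pf)
    (on_label pf) to_blowdown_trans) erefl.

Lemma blowdown_CSTS : is_CSTS blowdown.
Proof.
apply: pull_CSTS => [|y ym|v]; first exact: (svalP Y).1.
  exists (exist (fun x => collapse x = x) _ (collapse_section y)).
  split=> [|[x xC] /= xy]; first exact: section_state.
  apply: eq_exist; rewrite -xC /collapse xy; by case: asboolP.
have [c [d cd]] := all_actions_used (svalP Y).1 v.
exists (to_collapsed (on_state sf c)), (to_collapsed (on_state sf d)).
by rewrite /= !collapse_over !section_state.
Qed.

Lemma blowdown_star : star_shaped blowdown.
Proof.
apply: (star_image (f := to_blowdown)) (svalP X).2 => -[x xC].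
by exists x; apply: eq_exist.
Qed.

Lemma from_blowdown_base : on_state pf (sval (base blowdown)) = base (sval Y).
Proof. by rewrite /= collapse_over pt_base. Qed.

Definition from_blowdown : pt_map blowdown (sval Y) :=
  @PtMap _ blowdown (sval Y) (pull_proj (fun x : collapsed => on_state pf (sval x)))
    from_blowdown_base.

Lemma to_blowdown_cof :
  StarCSTS_cof (to_blowdown : hom X (star_obj blowdown_CSTS blowdown_star)).
Proof.
apply: star_cofI => x y /= /(congr1 sval) /= xy.
have pxy : on_state pf x = on_state pf y by rewrite -collapse_over xy collapse_over.
have [xm|nm] := pselect (middle (on_state pf x)); [right|left].
  have [c [d [us [vs [T ca ad]]]]] := xm.
  exists (to_collapsed (on_state sf c)), (to_collapsed (on_state sf d)), us, vs.
  by rewrite /= !collapse_over !section_state.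
by move: xy; rewrite /collapse -pxy; case: asboolP.
Qed.

(** Lifting against the cofibration [to_blowdown] gives a left inverse [r] of it. Since
    [to_blowdown] acts on actions as [p], injectivity follows; transitions over [Y] exist in
    [blowdown], and [r] carries them back to [X]. *)
Lemma star_rlp_blowup_section : blowup pf.
Proof.
have [|r [rc rp]] := pR to_blowdown_cof (a := idm X) (b := from_blowdown).
  rewrite compm1; apply/pt_map_eq/ps_map_eq; apply: funext => x //.
  by apply/esym; apply: collapse_over.
have [rcs rca] := ps_map_congr (congr1 (@pt_ps_map _ _ _) rc).
split.
- by move=> y; exists (on_state sf y); apply: section_state.
- by move=> u v puv; rewrite -[u]rca -[v]rca /= puv.
- by move=> v; exists (on_action sf v); apply: section_action.
move=> a us b T.
have : @trans _ blowdown (to_collapsed a) (map (on_action pf) us) (to_collapsed b).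
  by rewrite /= !collapse_over.
move=> /(on_trans (r : pt_map blowdown (sval X))).
rewrite -map_comp (eq_map (_ : _ =1 id)) ?map_id; last exact: rca.
by have /= -> := rcs a; have /= -> := rcs b.
Qed.
End Blowdown.

Lemma star_rlp_blowup X Y (p : hom X Y) :
  rlp (@StarCSTS_cof Sigma) p -> blowup (p : pt_map _ _).
Proof.
by move=> pR; have [s ps] := star_rlp_section pR; apply: star_rlp_blowup_section ps.
Qed.

(** A state and its image under [s] after [p] are interchangeable, so [g] cannot distinguish them
    and [g ∘ s] is the extension; [p] having a section gives uniqueness. *)
Lemma star_rlp_inverted X Y (p : hom X Y) :
  rlp (@StarCSTS_cof Sigma) p -> inverted (@is_reduced Sigma) p.
Proof.
move=> pR Z ZR g; have pB := star_rlp_blowup pR; have [s ps] := star_rlp_section pR.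
exists (g ∘ s); split=> [|h <-]; last by rewrite -Defs.compA ps compm1.
apply/pt_map_eq/ps_map_eq; apply: funext => x /=.
  apply: (interchangeable_eq _ (svalP X).2 ZR).
  by apply: (blowup_interchangeable pB); apply: (section_state ps).
congr on_action; apply: (blowup_inj pB); exact: (section_action ps).
Qed.

End StarTrivialFibrations.

Section StarModel.
Context (Sigma : Type) (M : model_structure (StarCSTS Sigma)) (HM : StarCSTS_model M).

Lemma star_trivial_fibration (X Y : StarCSTS Sigma) (p : hom X Y) :
  fib M p -> weq M p -> blowup (p : pt_map _ _).
Proof.
move=> pF pW; apply: star_rlp_blowup => A B i /HM.1 iC.
by have [_ /(_ _ _ p)[H _] _] := cof_trivfib_wfs M; apply: H.
Qed.

Lemma blowup_weq (X Y : StarCSTS Sigma) (p : hom X Y) :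
  blowup (p : pt_map _ _) -> weq M p.
Proof.
move=> pB; suff : capm (fib M) (weq M) p by case.
have [_ H _] := cof_trivfib_wfs M; apply/H => A B i /HM.1.
exact: blowup_star_rlp.
Qed.

Lemma star_weq_inverted (X Y : StarCSTS Sigma) (f : hom X Y) :
  weq M f -> inverted (@is_reduced Sigma) f.
Proof.
apply: (left_determined_inverted HM.2) => A B p pR; apply: star_rlp_inverted.
by move=> U V i /HM.1; apply: pR.
Qed.
End StarModel.

(** A transition between the image of [v] under [p] and a state [b] is reflected to one between [v]
    and the image of [b] under [c]; applying [q] returns it to [b], since [c] is also a section of
    [q]. *)
Lemma common_section_interchangeable (Sigma : Type) (V Z : pointed Sigma)
    (p q : pt_map V Z) (c : ps_map Z V) (v : state V) :
  blowup p -> blowup q -> ps_comp p c = ps_id Z -> ps_comp q c = ps_id Z ->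
  interchangeable (on_state p v) (on_state q v).
Proof.
have lift (r t : pt_map V Z) us b : blowup r -> ps_comp r c = ps_id Z ->
    ps_comp t c = ps_id Z ->
    (trans (on_state r v) us b -> trans (on_state t v) us b) /\
    (trans b us (on_state r v) -> trans b us (on_state t v)).
  move=> rB /ps_map_congr[rcs rca] /ps_map_congr[tcs tca].
  have mapc (k : pt_map V Z) : on_action (ps_comp k c) =1 id ->
      map (on_action k) (map (on_action c) us) = us.
    by move=> kc; rewrite -map_comp (eq_map kc) map_id.
  have rcb : on_state r (on_state c b) = b := rcs b.
  have tcb : on_state t (on_state c b) = b := tcs b.
  split=> T.
    have /(on_trans t) : trans v (map (on_action c) us) (on_state c b).
      by apply: (blowup_trans rB); rewrite mapc // rcb.
    by rewrite mapc // tcb.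
  have /(on_trans t) : trans (on_state c b) (map (on_action c) us) v.
    by apply: (blowup_trans rB); rewrite mapc // rcb.
  by rewrite mapc // tcb.
move=> pB qB pc qc us b.
by have [] := lift p q us b pB pc qc; have [] := lift q p us b qB qc pc.
Qed.

Section StarProduct.
Context (Sigma : Type) (X Y : StarCSTS Sigma).

Definition prod_obj : StarCSTS Sigma :=
  star_obj (prod_CSTS (svalP X).1 (svalP Y).1) (@prod_star _ (sval X) (sval Y)).

Definition fst_hom : hom prod_obj X := prod_fst (sval X) (sval Y).
Definition snd_hom : hom prod_obj Y := prod_snd (sval X) (sval Y).

Definition pair_hom (A : StarCSTS Sigma) (f : hom A X) (g : hom A Y) : hom A prod_obj :=
  pairing (svalP A).1 (svalP A).2 f g.

Lemma fst_pair (A : StarCSTS Sigma) (f : hom A X) (g : hom A Y) : fst_hom ∘ pair_hom f g = f.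
Proof. exact: pairing_fst. Qed.

Lemma snd_pair (A : StarCSTS Sigma) (f : hom A X) (g : hom A Y) : snd_hom ∘ pair_hom f g = g.
Proof. exact: pairing_snd. Qed.

Lemma prod_hom_eq (A : StarCSTS Sigma) (f g : hom A prod_obj) :
  fst_hom ∘ f = fst_hom ∘ g -> snd_hom ∘ f = snd_hom ∘ g -> f = g.
Proof. exact: prod_map_eq. Qed.

End StarProduct.

(** * Past-similarity in fibrant objects *)

Section FibrantObjects.
Context (Sigma : Type) (M : model_structure (StarCSTS Sigma)) (HM : StarCSTS_model M).

Definition path_obj n (w : n.-tuple Sigma) : StarCSTS Sigma :=
  star_obj (path_CSTS w) (@path_star _ _ w).

Definition cyl_obj (X : StarCSTS Sigma) : StarCSTS Sigma :=
  star_obj (cyl_CSTS (svalP X).1) (cyl_star (svalP X).2).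

(** It is injective on states, hence a cofibration, and a section of the blow-up [cyl_sigma], hence
    a weak equivalence. *)
Lemma cyl_gamma_trivial_cof (X : StarCSTS Sigma) e :
  capm (cof M) (weq M) (cyl_gamma (sval X) e : hom X (cyl_obj X)).
Proof.
split; first by apply/HM.1/star_cofI => x y /cyl_gamma_inj ->; left.
have [_ _ H] := weq_two_of_three M (cyl_gamma (sval X) e : hom X (cyl_obj X))
  (cyl_sigma (sval X) : hom (cyl_obj X) X).
apply: H; first exact/(blowup_weq HM)/cyl_sigma_blowup.
rewrite (_ : _ ∘ _ = idm X); last exact: cyl_sigma_gamma.
by apply: iso_weq; exists (idm X); rewrite comp1m.
Qed.

Lemma fib_rlp (X Y : StarCSTS Sigma) (p : hom X Y) :
  fib M p <-> rlp (capm (cof M) (weq M)) p.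
Proof. by have [_ H _] := trivcof_fib_wfs M; apply: H. Qed.

Context (Z : StarCSTS Sigma)
  (ZF : fib M (to_terminal (sval Z) : hom Z (terminal_obj Sigma))).

Lemma fibrant_extend (A B : StarCSTS Sigma) (i : hom A B) (a : hom A Z) :
  cof M i -> weq M i -> exists b : hom B Z, b ∘ i = a.
Proof.
move=> iC iW; have /fib_rlp ZR := ZF.
have [||b [ba _]] := ZR _ _ i _ a (to_terminal (sval B) : hom B (terminal_obj Sigma)).
- by split.
- exact: to_terminal_unique.
by exists b.
Qed.

(** The first coordinate of a lift is prescribed by the square; the second is extended by fibrancy
    of [Z]. *)
Lemma fib_fst : fib M (fst_hom Z Z).
Proof.
apply/fib_rlp => A B i [iC iW] a b ab.
have [c ca] := fibrant_extend (snd_hom Z Z ∘ a) iC iW.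
exists (pair_hom b c); split; last exact: fst_pair.
by apply: prod_hom_eq; rewrite Defs.compA ?fst_pair ?snd_pair.
Qed.

Lemma fib_snd : fib M (snd_hom Z Z).
Proof.
apply/fib_rlp => A B i [iC iW] a b ab.
have [c ca] := fibrant_extend (fst_hom Z Z ∘ a) iC iW.
exists (pair_hom c b); split; last exact: snd_pair.
by apply: prod_hom_eq; rewrite Defs.compA ?fst_pair ?snd_pair.
Qed.

Lemma fib_comp (A B D : StarCSTS Sigma) (f : hom A B) (g : hom B D) :
  fib M f -> fib M g -> fib M (g ∘ f).
Proof.
move=> /fib_rlp fR /fib_rlp gR; apply/fib_rlp => U V i iC a b abi.
have [|h [hi gh]] := gR _ _ i iC (f ∘ a) b; first by rewrite Defs.compA.
have [|k [ki fk]] := fR _ _ i iC a h; first by rewrite hi.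
by exists k; rewrite -Defs.compA fk.
Qed.

(* Both projections of a path object [V] of [Z] are blow-ups, with a common
   section. A homotopy of paths lifts to [V], so that its two ends are the
   projections of one state [v] of [V], whose transitions are determined by
   those of either end. *)
Lemma fibrant_past_similar (a b : state (sval Z)) :
  past_similar a b -> interchangeable a b.
Proof.
case=> n [w [f [g [[H [Hf Hg]] <- gb]]]].
(* The path object [V] factors the diagonal of [Z] as a trivial cofibration [c] followed by a
   fibration [e]. *)
have [_ _ /(_ _ _ (pair_hom (idm Z) (idm Z)))[V [c [e [[cC cW] eF ec]]]]] :=
  trivcof_fib_wfs M.
have triv (q : hom (prod_obj Z Z) Z) : fib M q -> q ∘ pair_hom (idm Z) (idm Z) = idm Z ->
    blowup (q ∘ e : pt_map (sval V) (sval Z)) /\ (q ∘ e) ∘ c = idm Z.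
  move=> qF qd; have qec : (q ∘ e) ∘ c = idm Z by rewrite -Defs.compA ec.
  split=> //; apply: (star_trivial_fibration HM); first exact: fib_comp.
  have [_ K _] := weq_two_of_three M c (q ∘ e); apply: K => //.
  by rewrite qec; apply: iso_weq; exists (idm Z); rewrite comp1m.
have [e1B e1c] := triv _ fib_fst (fst_pair _ _).
have [e2B e2c] := triv _ fib_snd (snd_pair _ _).
pose f' : hom (path_obj w) Z := f; pose H' : hom (cyl_obj (path_obj w)) Z := H.
pose sg : hom (cyl_obj (path_obj w)) (path_obj w) := cyl_sigma (path_ps w).
pose g0 : hom (path_obj w) (cyl_obj (path_obj w)) := cyl_gamma (path_ps w) false.
have sg0 : sg ∘ g0 = idm _ by apply: cyl_sigma_gamma.
have /fib_rlp eR := eF.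
(* The pair consisting of the constant homotopy on [f] and of [H] is lifted through [e]. On level 0
   both components are [f], so the lift may start as [c ∘ f']. *)
have [|h [hg eh]] := eR _ _ g0 (cyl_gamma_trivial_cof (path_obj w) false) (c ∘ f')
    (pair_hom (f' ∘ sg) H').
  rewrite Defs.compA ec; apply: prod_hom_eq; rewrite !Defs.compA ?fst_pair ?snd_pair ?comp1m.
    by rewrite -Defs.compA sg0 compm1.
  exact: esym Hf.
pose v := on_state (h : pt_map _ _) (cyl_in true (ord_max : state (path_ps w))).
have v1 : on_state (fst_hom Z Z ∘ e : pt_map _ _) v = path_end f.
  have fh : (fst_hom Z Z ∘ e) ∘ h = f' ∘ sg by rewrite -Defs.compA eh fst_pair.
  by have [+ _] := ps_map_congr (congr1 (@pt_ps_map _ _ _) fh); apply.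
have v2 : on_state (snd_hom Z Z ∘ e : pt_map _ _) v = b.
  have sh : (snd_hom Z Z ∘ e) ∘ h = H' by rewrite -Defs.compA eh snd_pair.
  rewrite -gb -Hg /path_end.
  by have [+ _] := ps_map_congr (congr1 (@pt_ps_map _ _ _) sh); apply.
rewrite -v1 -v2.
apply: (@common_section_interchangeable _ (sval V) (sval Z) _ _ (c : pt_map _ _) v e1B e2B).
  exact: (congr1 (@pt_ps_map _ (sval Z) (sval Z)) e1c).
exact: (congr1 (@pt_ps_map _ (sval Z) (sval Z)) e2c).
Qed.

End FibrantObjects.

Section Reflection.
Context (Sigma : Type) (M : model_structure (StarCSTS Sigma)) (HM : StarCSTS_model M).

Lemma weq_to_reduced (X : StarCSTS Sigma) :
  exists (Z : StarCSTS Sigma) (e : hom X Z), is_reduced Z /\ weq M e.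
Proof.
have [_ _ F] := trivcof_fib_wfs M.
have [Z [i [p [[_ iW] pF _]]]] := F _ _ (to_terminal (sval X) : hom X (terminal_obj Sigma)).
have ZF : fib M (to_terminal (sval Z) : hom Z (terminal_obj Sigma)).
  by rewrite (to_terminal_unique (to_terminal (sval Z)) p).
have [ZC ZS] := svalP Z.
(* Representatives are chosen for interchangeability, which contains past-similarity because [Z] is
   fibrant; this makes the quotient reduced. *)
have [rep [repP rep_eq]] := choose_representatives (base (sval Z))
  (@interchangeable_refl _ (sval Z)) (@interchangeable_sym _ (sval Z))
  (@interchangeable_trans _ (sval Z)).
pose q : hom Z (star_obj (@quot_CSTS _ _ ZC _ repP rep_eq) (@quot_star _ _ ZS _ repP rep_eq)) :=
  quot_map repP rep_eq.
exists _, (q ∘ i); split.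
  by apply: quot_reduced => // a b; apply: (fibrant_past_similar HM ZF).
have [c12 _ _] := weq_two_of_three M i q; apply: c12 => //.
exact/(blowup_weq HM)/quot_blowup.
Qed.

End Reflection.

Theorem theorem11p9 (Sigma : Type) (infinite_Sigma : infinite_set [set: Sigma]%classic)
    (M : model_structure (StarCSTS Sigma)) (HM : StarCSTS_model M) :
  (exists R : functor (StarCSTS Sigma) (RedStarCSTS Sigma),
     inhabited (adjunction R (red_inclusion Sigma))) /\
  forall (R : functor (StarCSTS Sigma) (RedStarCSTS Sigma))
         (adj : adjunction R (red_inclusion Sigma)),
    quillen_equivalence M (discrete_model (RedStarCSTS Sigma)) adj /\
    (forall (X Y : StarCSTS Sigma) (f : hom X Y), weq M f <-> is_iso (fmap R f)).
Proof.
split=> [|R adj].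
  apply: reflection_adjunction => X; have [Z [e [ZR eW]]] := weq_to_reduced HM X.
  by exists Z, e; split=> //; apply: (star_weq_inverted HM).
apply: reflection_quillen_equivalence => [X Y f|]; first exact: (star_weq_inverted HM).
exact: (weq_to_reduced HM).
Qed.
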